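(* Let $\mathcal{H}$ be a complex Hilbert space and let $[0,+\infty[\,\ni t\mapsto S(t)\in\mathcal{L}(\mathcal{H},\mathcal{H})$ be a strongly continuous semigroup with $S(0)=I$ and generator $A$. Suppose that for some pair $(\widehat M,\widehat\omega)$, with $\widehat M\ge 1$ and $\widehat\omega\in\mathbb{R}$, $$\|S(t)\|\le\widehat M e^{\widehat\omega t}\quad\text{for all } t\ge 0,$$ and that $r(\omega)>0$ for some real $\omega<\widehat\omega$. Then for all $t\ge 0$, $$\|S(t)\|\le\widehat M\left(1+\frac{2\widehat M(\widehat\omega-\omega)}{r(\omega)}\right)e^{\omega t}.$$
   Context: Norms are operator norms in $\mathcal{L}(\mathcal{H},\mathcal{H})$. The quantity $r(\omega)$ is defined by $$\frac{1}{r(\omega)}=\sup_{\operatorname{Re} z\ge\omega}\|(z-A)^{-1}\|.$$ The hypothesis $r(\omega)>0$ means that the half-plane $\{z\in\mathbb{C}:\operatorname{Re} z\ge\omega\}$ is contained in the resolvent set of $A$ and that this supremum is finite. *)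

(* Defs.v *)
From Stdlib Require Import Reals Lra Classical.
From Coquelicot Require Import Coquelicot.

Open Scope R_scope.

(* [norm] is the norm of the Coquelicot structure, so the last axiom says that
   it is the one induced by the inner product; positive definiteness follows. *)
Record HilbertSpace := {
  hilbert_space :> CompleteNormedModule C_AbsRing;
  inner : hilbert_space -> hilbert_space -> C;
  inner_plus_l : forall x y z, inner (plus x y) z = Cplus (inner x z) (inner y z);
  inner_scal_l : forall (k : C) x y, inner (scal k x) y = Cmult k (inner x y);
  inner_conj : forall x y, inner y x = Cconj (inner x y);
  inner_norm : forall x, inner x x = RtoC (norm x ^ 2)
}.

Section Operators.

Context {H : HilbertSpace}.

(* Only meaningful for bounded operators (Coquelicot's [is_linear]): the
   supremum is taken in [Rbar] and then projected to [R]. *)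
Definition op_norm (T : H -> H) : R :=
  real (Lub_Rbar (fun v => exists x : H, norm x <= 1 /\ v = norm (T x))).

Record C0_semigroup (S : R -> H -> H) : Prop := {
  C0_bounded : forall t, 0 <= t -> is_linear (S t);
  C0_zero : forall x, S 0 x = x;
  C0_add : forall s t x, 0 <= s -> 0 <= t -> S (s + t) x = S s (S t x);
  C0_continuous : forall x, continuous_on (fun t => 0 <= t) (fun t => S t x)
}.

(* Unbounded operators are represented by their graphs: [generator S x y] means
   that x is in the domain of the generator A and that A x = y. *)
Definition generator (S : R -> H -> H) (x y : H) : Prop :=
  filterlim (fun h : R => scal (RtoC (/ h)) (minus (S h x) x))
    (at_right 0) (locally y).

(* [Q] is the bounded, everywhere defined, two-sided inverse of
   z - A : D(A) -> H. *)
Definition is_resolvent (A : H -> H -> Prop) (z : C) (Q : H -> H) : Prop :=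
  is_linear Q /\
  (forall y : H, exists y' : H, A (Q y) y' /\ minus (scal z (Q y)) y' = y) /\
  (forall x x' : H, A x x' -> Q (minus (scal z x) x') = x).

Definition resolvent_set (A : H -> H -> Prop) (z : C) : Prop :=
  exists Q : H -> H, is_resolvent A z Q.

(* The norm of (z - A)^-1, with value +oo off the resolvent set. *)
Definition is_resolvent_norm (A : H -> H -> Prop) (z : C) (v : Rbar) : Prop :=
  (exists Q : H -> H, is_resolvent A z Q /\ v = Finite (op_norm Q)) \/
  (~ resolvent_set A z /\ v = p_infty).

Definition resolvent_sup (A : H -> H -> Prop) (w : R) : Rbar :=
  Rbar_lub (fun v => exists z : C, w <= Re z /\ is_resolvent_norm A z v).

(* The reciprocal on [0, +oo]; [Rbar_inv] does not send 0 to +oo.  The supremum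
   vanishes exactly when the space is {0}. *)
Definition Rbar_recip (x : Rbar) : Rbar :=
  match x with
  | Finite s => if Req_EM_T s 0 then p_infty else Finite (/ s)
  | _ => Finite 0
  end.

Definition r (A : H -> H -> Prop) (w : R) : Rbar :=
  Rbar_recip (resolvent_sup A w).

Lemma op_norm_ge0 (T : H -> H) : 0 <= op_norm T.
Proof.
unfold op_norm.
set (E := fun v => _).
destruct (Lub_Rbar_correct E) as [ub _].
assert (E0 : E (norm (T zero))).
{ exists zero; split; [|reflexivity].
  replace (norm (@zero H)) with 0; [lra | symmetry; exact (@norm_zero _ H)]. }
generalize (ub _ E0) (norm_ge_0 (T zero)).
destruct (Lub_Rbar E); simpl; lra.
Qed.

Lemma r_gt0 (A : H -> H -> Prop) (w : R) :
  Rbar_lt 0 (r A w) <->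
  (forall z : C, w <= Re z -> resolvent_set A z) /\
  is_finite (resolvent_sup A w).
Proof.
unfold r, resolvent_sup, Rbar_lub.
set (E := fun v => exists z : C, w <= Re z /\ is_resolvent_norm A z v).
destruct (Rbar_ex_lub E) as [l [ub lub]]; simpl.
assert (pos : forall v, E v -> Rbar_le 0 v).
{ intros v [z [_ [[Q [_ ->]]|[_ ->]]]]; simpl; [apply op_norm_ge0 | exact I]. }
assert (pos_l : Rbar_le 0 l).
{ assert (ex : exists v, E v).
  { destruct (classic (resolvent_set A (RtoC w))) as [[Q hQ]|hN].
    - exists (Finite (op_norm Q)), (RtoC w); split; [simpl; lra|].
      left; exists Q; auto.
    - exists p_infty, (RtoC w); split; [simpl; lra|]. right; auto. }
  destruct ex as [v hv].
  apply Rbar_le_trans with v; [exact (pos _ hv) | exact (ub _ hv)]. }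
assert (nneg : l <> m_infty) by (intros ->; exact pos_l).
split.
- intros hr.
  assert (fin : is_finite l).
  { destruct l; simpl in *; [reflexivity | lra | contradiction]. }
  split; [|exact fin].
  intros z hz; apply NNPP; intros hN.
  assert (hE : E p_infty) by (exists z; split; [exact hz | right; auto]).
  generalize (ub _ hE); rewrite <- fin; simpl; tauto.
- intros [_ fin].
  destruct l as [s| |]; simpl in *; [|discriminate fin|contradiction].
  destruct (Req_EM_T s 0); simpl; [exact I|].
  apply Rinv_0_lt_compat; lra.
Qed.

End Operators.

(* Main.v *)
Require Import Defs.
From Stdlib Require Import Reals Lra Lia Psatz List.
From Coquelicot Require Import Coquelicot.

Open Scope R_scope.

(** Write K for the supremum of the resolvent norm on the half-plane
    Re z >= w, so that K = 1 / r(w), and d for w_hat - w.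

    The heart of the matter is an energy inequality.  Let u(t) be the orbit
    exp(-s t) S(t) x with s >= w, and let chi be a compactly supported cutoff
    on [0, +oo[ with chi(0) = 0.  Since (chi u)' = (A - s) (chi u) + chi' u,
    the Fourier transform turns this equation into a resolvent equation on the
    line Re z = s, and Plancherel gives
      int |chi u|^2 <= K^2 int |chi' u|^2.
    It is obtained here as the limit of an exact discrete inequality.  Time is
    discretised by the implicit Euler scheme of step h: for a finitely
    supported sequence w with defect g, multiplying by z^j with |z| = 1 and
    summing gives a resolvent equation at the point (1 - z)/h, which lies in
    the right half-plane ([euler_transform_bound]).
    Parseval's identity on suitable roots of unity, which follows from the
    parallelogram law alone ([parseval]), turns this into an l^2 bound
    ([euler_energy]).  For x in the domain of A the sampled orbit solves the
    scheme up to an error tending to 0 with h, and the limit of the resulting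
    Riemann sums is the energy inequality for cutoffs that rise on [0, a] with
    slope phi, stay constant up to c, and decrease linearly on an interval of
    length N ([integral_cutoff]).

    The contribution of the descent, of order K^2/N^2 times an integral of
    |u|^2, has to disappear as N grows, which requires |u|^2 to be integrable
    at s = w.  This is obtained by lowering s from w_hat to w in steps of a
    fixed size eta: at each level the energy grows at most like exp(2 eta t),
    and the energy inequality with N at least 2 K absorbs such a growth
    ([energy_absorption], [finite_energy_at_abscissa]).

    The final choice is a = t/2, c = t and phi(s) = exp(-2 d s), with
    Y = int_0^a phi = (1 - exp(-d t))/(2 d).  Bounding |u| from above on [0, a]
    and from below, by a multiple of |u(t)|, on [a, t] gives
      |u(t)| (1 - exp(-d t)) <= 2 d K M^2 |x|.
    Adding exp(-d t) |u(t)| <= M |x|, which is the assumed bound, yields the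
    claim on the domain of A ([orbit_decay]).  The domain is dense
    ([generator_dense]). *)

(** * Finite sums *)

(** [sum_n] has n + 1 terms, which is inconvenient for splitting a range of
    indices into blocks; this sum has n terms. *)
Fixpoint sum_lt {G : AbelianMonoid} (u : nat -> G) (n : nat) : G :=
  match n with
  | O => zero
  | S k => plus (sum_lt u k) (u k)
  end.

Section Sums.
Context {G : AbelianMonoid}.
Implicit Types u v : nat -> G.

Lemma sum_lt_ext u v n :
  (forall j, (j < n)%nat -> u j = v j) -> sum_lt u n = sum_lt v n.
Proof.
induction n as [|n IH]; intros e; simpl; [reflexivity|].
rewrite IH, e; auto with arith.
Qed.

Lemma sum_lt_plus u v n :
  sum_lt (fun j => plus (u j) (v j)) n = plus (sum_lt u n) (sum_lt v n).
Proof.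
induction n as [|n IH]; simpl; [now rewrite plus_zero_l|].
rewrite IH, <- !plus_assoc. f_equal.
rewrite !plus_assoc. f_equal. apply plus_comm.
Qed.

Lemma sum_lt_split u n m :
  sum_lt u (n + m) = plus (sum_lt u n) (sum_lt (fun j => u (n + j)%nat) m).
Proof.
induction m as [|m IH].
- rewrite Nat.add_0_r; simpl; now rewrite plus_zero_r.
- rewrite Nat.add_succ_r; simpl. now rewrite IH, plus_assoc.
Qed.

Lemma sum_lt_zero u n :
  (forall j, (j < n)%nat -> u j = zero) -> sum_lt u n = zero.
Proof.
induction n as [|n IH]; intros e; simpl; [reflexivity|].
rewrite IH, e, plus_zero_l; auto with arith.
Qed.

Lemma sum_lt_succ_l u n :
  sum_lt u (S n) = plus (u O) (sum_lt (fun j => u (S j)) n).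
Proof.
change (S n) with (1 + n)%nat. rewrite sum_lt_split; simpl.
now rewrite plus_zero_l.
Qed.

End Sums.

Lemma sum_lt_scal {K : Ring} {V : ModuleSpace K} (k : K) (u : nat -> V) n :
  sum_lt (fun j => scal k (u j)) n = scal k (sum_lt u n).
Proof.
induction n as [|n IH]; simpl; [now rewrite scal_zero_r|].
now rewrite IH, scal_distr_l.
Qed.

Lemma sum_lt_Rext (u v : nat -> R) n :
  (forall j, (j < n)%nat -> u j = v j) -> sum_lt u n = sum_lt v n.
Proof. exact (sum_lt_ext u v n). Qed.

Lemma sum_lt_Rmult (c : R) (u : nat -> R) n :
  sum_lt (fun j => c * u j) n = c * sum_lt u n.
Proof. exact (sum_lt_scal (V := R_ModuleSpace) c u n). Qed.

Lemma sum_lt_Rplus (u v : nat -> R) n :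
  sum_lt (fun j => u j + v j) n = sum_lt u n + sum_lt v n.
Proof. exact (sum_lt_plus u v n). Qed.

Lemma sum_lt_Rsplit (u : nat -> R) n m :
  sum_lt u (n + m) = sum_lt u n + sum_lt (fun j => u (n + j)%nat) m.
Proof. exact (sum_lt_split u n m). Qed.

Lemma sum_lt_le (u v : nat -> R) n :
  (forall j, (j < n)%nat -> u j <= v j) -> sum_lt u n <= sum_lt v n.
Proof.
induction n as [|n IH]; intros e; simpl; [apply Rle_refl|].
apply Rplus_le_compat; auto with arith.
Qed.

Lemma sum_lt_const (c : R) n : sum_lt (fun _ => c) n = INR n * c.
Proof.
induction n as [|n IH]; [simpl; unfold zero; simpl; ring|].
rewrite S_INR. simpl sum_lt. rewrite IH. unfold plus; simpl. ring.
Qed.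

(** * Parseval's identity on roots of unity *)

Definition sum_list (f : C -> R) (l : list C) : R :=
  fold_right (fun z acc => f z + acc) 0 l.

Lemma sum_list_app f l1 l2 :
  sum_list f (l1 ++ l2) = sum_list f l1 + sum_list f l2.
Proof. induction l1 as [|z l IH]; simpl; [ring|]. rewrite IH; ring. Qed.

Lemma sum_list_ext f g l :
  (forall z, In z l -> f z = g z) -> sum_list f l = sum_list g l.
Proof.
induction l as [|z l IH]; intros e; simpl; [reflexivity|].
rewrite IH, e; auto with datatypes.
Qed.

Lemma sum_list_le f g l :
  (forall z, In z l -> f z <= g z) -> sum_list f l <= sum_list g l.
Proof.
induction l as [|z l IH]; intros e; simpl; [apply Rle_refl|].
apply Rplus_le_compat; auto with datatypes.
Qed.

Lemma sum_list_scal c f l : sum_list (fun z => c * f z) l = c * sum_list f l.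
Proof. induction l as [|z l IH]; simpl; [ring|]. rewrite IH; ring. Qed.

(** Half-angle formulas: for s = a + i b the root has coordinates
    sqrt((1 + a)/2) and, up to sign, sqrt((1 - a)/2). *)
Lemma unit_sqrt (s : C) :
  Cmod s = 1 -> exists q : C, Cmod q = 1 /\ (q * q)%C = s.
Proof.
destruct s as [a b]; intros hs.
assert (h : a * a + b * b = 1).
{ unfold Cmod in hs; simpl in hs. apply (f_equal (fun x => x * x)) in hs.
  rewrite sqrt_sqrt in hs; nra. }
assert (ha : 0 <= (1 + a) / 2 /\ 0 <= (1 - a) / 2) by (split; nra).
assert (e1 := sqrt_sqrt _ (proj1 ha)). assert (e2 := sqrt_sqrt _ (proj2 ha)).
assert (p1 := sqrt_pos ((1 + a) / 2)). assert (p2 := sqrt_pos ((1 - a) / 2)).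
revert e1 e2 p1 p2.
generalize (sqrt ((1 + a) / 2)) (sqrt ((1 - a) / 2)); intros c d e1 e2 p1 p2.
assert (hq : (2 * c * d) * (2 * c * d) = b * b) by nra.
assert (mod1 : forall e, e * e = d * d -> Cmod (c, e) = 1).
{ intros e he. unfold Cmod; simpl. apply eq_trans with (2 := sqrt_1), f_equal. lra. }
destruct (Rle_lt_dec 0 b) as [hb|hb].
- exists (c, d); split; [apply mod1; ring|].
  unfold Cmult; simpl. assert (0 <= c * d) by nra.
  f_equal; nra.
- exists (c, - d); split; [apply mod1; ring|].
  unfold Cmult; simpl. assert (0 <= c * d) by nra.
  f_equal; nra.
Qed.

Section Fourier.
Context {H : HilbertSpace}.
Implicit Types (x y : H) (v : nat -> H).

Lemma scalDl (k : C) x y : scal k (plus x y) = plus (scal k x) (scal k y).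
Proof. exact (scal_distr_l k x y). Qed.
Lemma scalA (k l : C) x : scal k (scal l x) = scal (k * l)%C x.
Proof. exact (scal_assoc k l x). Qed.
Lemma scal1 x : scal (RtoC 1) x = x.
Proof. exact (scal_one x). Qed.
Lemma scal0 x : scal (RtoC 0) x = zero.
Proof. exact (scal_zero_l x). Qed.
Lemma scalr0 (k : C) : scal k (@zero H) = zero.
Proof. exact (scal_zero_r k). Qed.
Lemma scalN (k : C) x : scal (- k)%C x = opp (scal k x).
Proof. exact (scal_opp_l k x). Qed.
Lemma oppE x : opp x = scal (- RtoC 1)%C x.
Proof. symmetry; exact (scal_opp_one x). Qed.

Lemma inner_plus_r x y z : inner H z (plus x y) = Cplus (inner H z x) (inner H z y).
Proof.
rewrite inner_conj, inner_plus_l, Cplus_conj, <- !inner_conj. reflexivity.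
Qed.

Lemma inner_scal_r (k : C) x y :
  inner H x (scal k y) = Cmult (Cconj k) (inner H x y).
Proof.
rewrite inner_conj, inner_scal_l, Cmult_conj, <- inner_conj. reflexivity.
Qed.

Lemma norm_scal_eq (k : C) x : norm (scal k x) = Cmod k * norm x.
Proof.
apply Rsqr_inj; [apply norm_ge_0| apply Rmult_le_pos; [apply Cmod_ge_0|apply norm_ge_0] |].
assert (e := inner_norm H (scal k x)).
rewrite inner_scal_l, inner_scal_r, inner_norm, Cmult_assoc, <- Cmod2_conj in e.
apply (f_equal fst) in e. simpl in e. unfold Rsqr. nra.
Qed.

(** This is how the geometry of the Hilbert space enters the estimates; the
    decay bound fails in general Banach spaces. *)
Lemma parallelogram x y :
  norm (plus x y) ^ 2 + norm (plus x (opp y)) ^ 2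
  = 2 * (norm x ^ 2 + norm y ^ 2).
Proof.
rewrite oppE.
assert (e1 := inner_norm H (plus x y)).
assert (e2 := inner_norm H (plus x (scal (Copp (RtoC 1)) y : H))).
rewrite inner_plus_l, !inner_plus_r, !inner_norm in e1.
rewrite inner_plus_l, !inner_plus_r, !inner_scal_l, !inner_scal_r, !inner_norm
  in e2.
apply (f_equal fst) in e1. apply (f_equal fst) in e2.
revert e1 e2. generalize (inner H x y) (inner H y x); intros [a b] [c d].
simpl. intros. lra.
Qed.

Definition fourier v (n : nat) (z : C) : H := sum_lt (fun j => scal (z ^ j)%C (v j)) n.

(** The radix-2 step of the fast Fourier transform: at the points where
    z^n = s, the two halves of the sequence are superposed with weight s. *)
Lemma fourier_fold v n z (s : C) :
  (z ^ n)%C = s ->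
  fourier v (n + n) z = fourier (fun j => plus (v j) (scal s (v (n + j)%nat))) n z.
Proof.
intros <-. unfold fourier. rewrite sum_lt_split, <- sum_lt_plus.
apply sum_lt_ext; intros j _.
rewrite scalDl, scalA. do 2 f_equal.
rewrite Cpow_add_r. apply Cmult_comm.
Qed.

(** The roots of z^(2^p) = s are those of z^(2^(p-1)) = q and
    z^(2^(p-1)) = -q, where q is a square root of s.  By [fourier_fold] the
    transforms at these two families involve low + q high and low - q high, and
    the parallelogram law adds up their energies.  The induction needs a
    general s: even for s = 1 the two families belong to 1 and -1. *)
Lemma parseval p : forall s : C, Cmod s = 1 ->
  exists l : list C,
    (forall z, In z l -> Cmod z = 1 /\ (z ^ (2 ^ p))%C = s) /\
    forall v, sum_list (fun z => norm (fourier v (2 ^ p) z) ^ 2) l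
              = 2 ^ p * sum_lt (fun j => norm (v j) ^ 2) (2 ^ p).
Proof.
induction p as [|p IH]; intros s hs.
- exists (s :: nil); split.
  + intros z [<-|[]]; split; [exact hs|]. simpl; ring.
  + intros v; unfold fourier; simpl.
    rewrite plus_zero_l, scal1. unfold plus, zero; simpl. ring.
- destruct (unit_sqrt s hs) as [q [hq eq]].
  assert (hq' : Cmod (- q) = 1) by now rewrite Cmod_opp.
  destruct (IH q hq) as [l1 [r1 e1]]. destruct (IH _ hq') as [l2 [r2 e2]].
  replace (2 ^ S p)%nat with (2 ^ p + 2 ^ p)%nat by (simpl; lia).
  exists (l1 ++ l2); split.
  + intros z hz. apply in_app_or in hz.
    rewrite Cpow_add_r.
    destruct hz as [hz|hz]; [destruct (r1 z hz) as [m e]|destruct (r2 z hz) as [m e]];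
      (split; [exact m|]); rewrite e, <- eq; ring.
  + intros v. rewrite sum_list_app.
    rewrite (sum_list_ext _ _ l1 (fun z hz =>
      f_equal (fun y => norm y ^ 2) (fourier_fold v _ z q (proj2 (r1 z hz))))).
    rewrite (sum_list_ext _ _ l2 (fun z hz =>
      f_equal (fun y => norm y ^ 2) (fourier_fold v _ z _ (proj2 (r2 z hz))))).
    rewrite e1, e2, <- Rmult_plus_distr_l.
    rewrite <- sum_lt_Rplus, sum_lt_Rsplit, <- sum_lt_Rplus.
    rewrite (sum_lt_Rext _ (fun j =>
      2 * (norm (v j) ^ 2 + norm (v (2 ^ p + j)%nat) ^ 2))).
    * rewrite sum_lt_Rmult. simpl. ring.
    * intros j _. rewrite scalN, parallelogram, norm_scal_eq, hq. ring.
Qed.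
End Fourier.

(** * Vector identities through the inner product *)

Section VectorAlgebra.
Context {H : HilbertSpace}.
Implicit Types (x y : H) (v w g : nat -> H).

Lemma inner_opp_l x y : inner H (opp x) y = Copp (inner H x y).
Proof. rewrite oppE, inner_scal_l. ring. Qed.

Lemma inner_minus_l x y u : inner H (minus x y) u = Cminus (inner H x u) (inner H y u).
Proof. unfold minus. rewrite inner_plus_l, inner_opp_l. reflexivity. Qed.

Lemma inner_zero_l x : inner H zero x = RtoC 0.
Proof.
transitivity (inner H (scal (RtoC 0) x) x); [now rewrite scal0|].
rewrite inner_scal_l. ring.
Qed.

Lemma inner_ext x y : (forall u, inner H x u = inner H y u) -> x = y.
Proof.
intros e.
assert (e0 := inner_norm H (minus x y)).
rewrite inner_minus_l, e in e0.
apply (f_equal fst) in e0. simpl in e0.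
assert (n0 : norm (minus x y) = 0) by nra.
assert (d : minus x y = zero) by exact (norm_eq_zero _ n0).
transitivity (plus (minus x y) y).
- unfold minus. now rewrite <- plus_assoc, plus_opp_l, plus_zero_r.
- rewrite d. exact (plus_zero_l y).
Qed.

End VectorAlgebra.

(** A vector identity is checked by pairing both sides with an arbitrary
    vector, which leaves an identity between complex numbers for [ring] or
    [field].  The goals are matched with the structure argument of each
    operation left open, because the same operation of the Hilbert space is
    reached through several convertible structures. *)
Ltac push_inner := repeat match goal with
  | |- context [inner ?H (@plus ?G ?a ?b) ?u] =>
      rewrite (inner_plus_l H a b u : inner H (@plus G a b) u = _)
  | |- context [inner ?H (@minus ?G ?a ?b) ?u] =>
      rewrite (inner_minus_l a b u : inner H (@minus G a b) u = _)
  | |- context [inner ?H (@opp ?G ?a) ?u] =>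
      rewrite (inner_opp_l a u : inner H (@opp G a) u = _)
  | |- context [inner ?H (@scal ?K ?G ?k ?a) ?u] =>
      rewrite (inner_scal_l H k a u : inner H (@scal K G k a) u = _)
  | |- context [inner ?H (@zero ?G) ?u] =>
      rewrite (inner_zero_l u : inner H (@zero G) u = _)
  end.
Ltac vec_eq := apply inner_ext; let u := fresh "u" in intros u; push_inner.

(** * Implicit Euler schemes and the resolvent *)

Section Discrete.
Context {H : HilbertSpace}.
Implicit Types (x y : H) (v w g : nat -> H) (A : H -> H -> Prop).

Lemma norm_opp_eq x : norm (opp x) = norm x.
Proof. exact (norm_opp x). Qed.

Lemma norm_minus_sym x y : norm (minus x y) = norm (minus y x).
Proof. rewrite <- norm_opp_eq. f_equal. vec_eq. ring. Qed.

Lemma norm_triangle_minus x y : norm x <= norm (minus x y) + norm y.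
Proof.
replace x with (plus (minus x y) y) at 1 by (vec_eq; ring).
exact (norm_triangle (minus x y) y).
Qed.

Record linear_relation A : Prop := {
  lr_zero : A zero zero;
  lr_plus : forall x x' y y', A x x' -> A y y' -> A (plus x y) (plus x' y');
  lr_scal : forall (k : C) x x', A x x' -> A (scal k x) (scal k x')
}.

(** What the resolvent bound says about the graph of A; together with density
    of the domain, this is all that is used of the resolvent. *)
Definition coercive_on_half_plane A (s K : R) : Prop :=
  forall (z : C) x x', s <= Re z -> A x x' -> norm x <= K * norm (minus (scal z x : H) x' : H).

(** Since the sequence vanishes at both ends, shifting it loses no term. *)
Lemma fourier_shift w n z :
  w O = zero -> w n = zero ->
  scal z (fourier (fun j => w (S j)) n z) = fourier w n z.
Proof.
intros w0 wn. unfold fourier.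
transitivity (sum_lt (fun j => scal (z ^ j)%C (w j) : H) (S n)).
- rewrite <- sum_lt_scal, sum_lt_succ_l, w0, scalr0, plus_zero_l.
  apply sum_lt_ext; intros j _. now rewrite scalA.
- simpl sum_lt. rewrite wn, scalr0. apply plus_zero_r.
Qed.

Lemma fourier_relation A w v n z :
  linear_relation A -> (forall j, A (w j) (v j)) ->
  A (fourier w n z) (fourier v n z).
Proof.
intros [A0 Ap As] hA; unfold fourier.
induction n as [|n IH]; simpl; [exact A0|]. apply Ap; [exact IH|]. now apply As.
Qed.

Lemma fourier_plus v w n z :
  fourier (fun j => plus (v j) (w j)) n z = plus (fourier v n z) (fourier w n z).
Proof.
unfold fourier. rewrite <- sum_lt_plus. apply sum_lt_ext; intros; apply scalDl.
Qed.

Lemma fourier_scal (k : C) v n z :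
  fourier (fun j => scal k (v j)) n z = scal k (fourier v n z).
Proof.
unfold fourier. rewrite <- sum_lt_scal. apply sum_lt_ext; intros.
rewrite !scalA, Cmult_comm. reflexivity.
Qed.

Lemma fourier_ext v w n z :
  (forall j, v j = w j) -> fourier v n z = fourier w n z.
Proof. intros e; apply sum_lt_ext; intros; now rewrite e. Qed.

(** The transformed scheme, W = zW + hV + hzG, solved for the right-hand side of
    the resolvent equation. *)
Lemma euler_symbol (h : R) (z W V G : C) : h <> 0 ->
  W = (z * W + h * (V + z * G))%C -> (z * G)%C = ((1 - z) / h * W - V)%C.
Proof.
intros h0 E. assert (hc : RtoC h <> 0) by (intros e; now apply RtoC_inj in e).
transitivity ((W - z * W) / h - V)%C; [rewrite E at 1|]; now field.
Qed.

(** The backward difference quotient has symbol (1 - z)/h, whose real part is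
    nonnegative on the unit circle: the implicit scheme only samples the
    resolvent in the half-plane where it is bounded, for every step h. *)
Lemma euler_transform_bound A K (h : R) w v g m z :
  linear_relation A -> coercive_on_half_plane A 0 K -> 0 < h ->
  (forall j, A (w j) (v j)) ->
  w O = zero -> v O = zero -> w m = zero -> v m = zero ->
  (forall j, w (S j) = plus (w j) (scal (RtoC h) (plus (v (S j)) (g j)))) ->
  Cmod z = 1 ->
  norm (fourier w m z) <= K * norm (fourier g m z).
Proof.
intros lA hK hh hA w0 v0 wm vm step hz.
assert (E : fourier w m z =
  plus (scal z (fourier w m z))
    (scal (RtoC h) (plus (fourier v m z) (scal z (fourier g m z))))).
{ rewrite <- (fourier_shift w m z w0 wm) at 1.
  rewrite <- (fourier_shift v m z v0 vm).
  rewrite (fourier_ext _ _ m z step), fourier_plus, fourier_scal, fourier_plus.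
  vec_eq. ring. }
assert (hre : 0 <= Re ((1 - z) / RtoC h)%C).
{ replace ((1 - z) / RtoC h)%C with (RtoC (/ h) * (1 - z))%C.
  2:{ rewrite RtoC_inv by lra. unfold Cdiv. ring. }
  assert (hle := re_le_Cmod z).
  destruct z as [a b]; simpl in *. rewrite hz in hle.
  assert (0 < / h) by now apply Rinv_0_lt_compat.
  unfold Rabs in hle; destruct (Rcase_abs a); nra. }
generalize (hK _ _ _ hre (fourier_relation A w v m z lA hA)).
replace (minus (scal ((1 - z) / RtoC h)%C (fourier w m z) : H) (fourier v m z))
  with (scal z (fourier g m z) : H).
- now rewrite norm_scal_eq, hz, Rmult_1_l.
- apply inner_ext; intros u.
  apply (f_equal (fun x => inner H x u)) in E. revert E. push_inner.
  apply euler_symbol. lra.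
Qed.

Lemma sum_lt_tail0 (u : nat -> R) n m :
  (n <= m)%nat -> (forall j, (n <= j)%nat -> u j = 0) -> sum_lt u m = sum_lt u n.
Proof.
intros hnm h0. replace m with (n + (m - n))%nat by lia.
rewrite sum_lt_Rsplit.
replace (sum_lt (fun j => u (n + j)%nat) (m - n)) with 0; [apply Rplus_0_r|].
symmetry. apply (sum_lt_zero (G := R_AbelianMonoid)). intros j _. apply h0. lia.
Qed.

(** The discrete form of Plancherel's argument.  Padding the sequences by zeros
    up to a power of two makes [parseval] applicable. *)
Lemma euler_energy A K (h : R) n w v g :
  linear_relation A -> coercive_on_half_plane A 0 K -> 0 <= K -> 0 < h ->
  (forall j, A (w j) (v j)) -> w O = zero -> v O = zero ->
  (forall j, (n <= j)%nat -> w j = zero /\ v j = zero /\ g j = zero) ->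
  (forall j, w (S j) = plus (w j) (scal (RtoC h) (plus (v (S j)) (g j)))) ->
  sum_lt (fun j => norm (w j) ^ 2) n <= K ^ 2 * sum_lt (fun j => norm (g j) ^ 2) n.
Proof.
intros lA hK K0 hh hA w0 v0 supp step.
assert (hn : (n <= 2 ^ n)%nat) by (apply Nat.lt_le_incl, Nat.pow_gt_lin_r; lia).
assert (nz : norm (@zero H) = 0) by exact (@norm_zero _ H).
rewrite <- (sum_lt_tail0 (fun j => norm (w j) ^ 2) n (2 ^ n) hn).
2:{ intros j hj. rewrite (proj1 (supp j hj)), nz. ring. }
rewrite <- (sum_lt_tail0 (fun j => norm (g j) ^ 2) n (2 ^ n) hn).
2:{ intros j hj. rewrite (proj2 (proj2 (supp j hj))), nz. ring. }
destruct (supp _ hn) as [wm [vm _]].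
destruct (parseval (H := H) n (RtoC 1)) as [l [hl par]].
{ rewrite Cmod_R. apply Rabs_R1. }
assert (pos : 0 < 2 ^ n) by (apply pow_lt; lra).
apply Rmult_le_reg_l with (1 := pos).
rewrite <- par. rewrite <- Rmult_assoc, (Rmult_comm (2 ^ n)), Rmult_assoc, <- par.
rewrite <- sum_list_scal.
apply sum_list_le; intros z hz.
rewrite <- Rpow_mult_distr. apply pow_incr. split; [apply norm_ge_0|].
apply (euler_transform_bound A K h w v g); auto. now apply hl.
Qed.

End Discrete.

(** * Riemann sums and a growth lemma *)

Lemma continuous_ex_RInt (f : R -> R) a b :
  (forall s, continuous f s) -> ex_RInt f a b.
Proof. intros hf. apply (ex_RInt_continuous (V := R_CompleteNormedModule)). auto. Qed.

Lemma RInt_cell (f : R -> R) a h e :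
  (forall s, continuous f s) -> 0 <= h ->
  (forall s, a <= s <= a + h -> Rabs (f s - f a) <= e) ->
  Rabs (h * f a - RInt f a (a + h)) <= e * h.
Proof.
intros cf hh he.
replace (h * f a - RInt f a (a + h)) with (- RInt (fun s => f s - f a) a (a + h)).
- rewrite Rabs_Ropp. replace (e * h) with ((a + h - a) * e) by ring.
  apply abs_RInt_le_const; [lra| |exact he].
  apply (continuous_ex_RInt (fun s => f s - f a)). intros s.
  apply (continuous_minus f (fun _ => f a)); [apply cf|apply continuous_const].
- assert (E : RInt (fun s => minus (f s) (f a)) a (a + h) =
    minus (RInt f a (a + h)) (RInt (fun _ => f a) a (a + h))).
  { apply (RInt_minus (V := R_CompleteNormedModule) f (fun _ => f a));
      apply continuous_ex_RInt; [exact cf| intros; apply continuous_const]. }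
  rewrite RInt_const in E.
  unfold Rminus at 2.
  match goal with |- - ?I = _ => change I with (RInt (fun s => minus (f s) (f a)) a (a + h)) end.
  rewrite E. unfold minus, plus, opp, scal; simpl; unfold mult; simpl. ring.
Qed.

Lemma RInt_Chasles_R (f : R -> R) a b c :
  (forall s, continuous f s) -> RInt f a c = RInt f a b + RInt f b c.
Proof.
intros cf. symmetry.
apply (RInt_Chasles (V := R_CompleteNormedModule) f a b c);
  now apply continuous_ex_RInt.
Qed.

Lemma RInt_cells (f : R -> R) a h e N :
  (forall s, continuous f s) -> 0 <= h ->
  (forall s t, a <= s <= a + INR N * h -> a <= t <= a + INR N * h ->
     Rabs (t - s) <= h -> Rabs (f t - f s) <= e) ->
  Rabs (h * sum_lt (fun i => f (a + INR i * h)) N - RInt f a (a + INR N * h))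
    <= e * (INR N * h).
Proof.
intros cf hh. induction N as [|N IH]; intros he.
- simpl. rewrite Rmult_0_l, Rplus_0_r, (RInt_point a f). unfold zero; simpl.
  rewrite Rmult_0_r, Rminus_0_r, Rabs_R0. lra.
- rewrite S_INR in he |- *.
  assert (pN := pos_INR N).
  assert (NH : 0 <= INR N * h) by now apply Rmult_le_pos.
  replace (a + (INR N + 1) * h) with (a + INR N * h + h) in * by ring.
  rewrite (RInt_Chasles_R f a (a + INR N * h)) by exact cf.
  simpl sum_lt. unfold plus; simpl.
  assert (H1 := IH ltac:(intros; apply he; lra)).
  assert (H2 := RInt_cell f (a + INR N * h) h e cf hh
    ltac:(intros; apply he; try lra; rewrite Rabs_pos_eq; lra)).
  revert H1 H2. set (A := sum_lt _ N). intros H1 H2.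
  replace (h * (A + f (a + INR N * h)) - _) with
   ((h * A - RInt f a (a + INR N * h)) +
    (h * f (a + INR N * h) - RInt f (a + INR N * h) (a + INR N * h + h))) by ring.
  eapply Rle_trans; [apply Rabs_triang|]. lra.
Qed.

(** The step dividing [a] into [n + 1] cells; the shift avoids a division by
    zero along the sequences indexed by n. *)
Definition mesh (a : R) (n : nat) : R := a / INR (S n).

Lemma mesh_pos a n : 0 < a -> 0 < mesh a n.
Proof.
intros ha. unfold mesh. apply Rdiv_lt_0_compat; [exact ha|].
apply lt_0_INR; lia.
Qed.

Lemma mesh_mult a q n : INR (q * S n) * mesh a n = INR q * a.
Proof.
unfold mesh. rewrite mult_INR. field. apply not_0_INR; lia.
Qed.

Lemma mesh_lim a : is_lim_seq (mesh a) 0.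
Proof.
unfold mesh.
replace (Finite 0) with (Rbar_mult a 0) by (simpl; f_equal; ring).
apply is_lim_seq_scal_l.
apply (is_lim_seq_incr_1 (fun n => / INR n)).
replace (Finite 0) with (Rbar_inv p_infty) by reflexivity.
apply is_lim_seq_inv; [apply is_lim_seq_INR|discriminate].
Qed.

Lemma riemann_sum_lim (f : R -> R) a c q :
  0 < a -> (forall s, continuous f s) ->
  is_lim_seq (fun n => mesh a n *
                sum_lt (fun i => f (c + INR i * mesh a n)) (q * S n))
    (RInt f c (c + INR q * a)).
Proof.
intros ha cf. apply is_lim_seq_Reals. intros eps heps.
set (T := INR q * a).
assert (hT : 0 <= T) by (apply Rmult_le_pos; [apply pos_INR|lra]).
assert (he : 0 < eps / (2 * (T + 1))) by (apply Rdiv_lt_0_compat; lra).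
destruct (Heine_cor2 (f := f) (a := c) (b := c + T)
  ltac:(intros; apply continuity_pt_filterlim, cf) (mkposreal _ he)) as [d hd].
destruct (proj1 (is_lim_seq_Reals _ _) (mesh_lim a) d (cond_pos d)) as [N hN].
exists N. intros n hn. unfold R_dist.
assert (mp := mesh_pos a n ha).
assert (hm := hN n hn). unfold R_dist in hm.
rewrite Rminus_0_r, Rabs_pos_eq in hm by lra.
generalize (RInt_cells f c (mesh a n) (eps / (2 * (T + 1))) (q * S n) cf
  ltac:(lra)).
rewrite mesh_mult. fold T. intros B.
eapply Rle_lt_trans; [apply B|].
- intros s t hs ht hst. left. apply (hd t s); auto. lra.
- assert (eps / (2 * (T + 1)) * T <= eps / (2 * (T + 1)) * (T + 1))
    by (apply Rmult_le_compat_l; lra).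
  assert (eps / (2 * (T + 1)) * (T + 1) = eps / 2) by (field; lra). lra.
Qed.

(** Iterating the recursive inequality n times leaves the sum of a geometric
    series and the remainder q^n f(l + n m), which the growth hypothesis makes
    at most 2^(-n) D G^l. *)
Lemma geometric_absorption (f : nat -> R) (C D G q : R) (m : nat) :
  0 <= C -> 0 <= q <= / 2 -> 0 <= G ->
  q * G ^ m <= / 2 ->
  (forall l, f l <= C + q * f (l + m)%nat) ->
  (forall l, f l <= D * G ^ l) -> 0 <= D ->
  forall l, f l <= 2 * C.
Proof.
intros hC hq hG hqG rec growth hD.
assert (it : forall n l, f l <= 2 * C + (/ 2) ^ n * (D * G ^ l)).
{ induction n as [|n IH]; intros l.
  - simpl. generalize (growth l). lra.
  - eapply Rle_trans; [apply rec|].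
    assert (I := IH (l + m)%nat). rewrite pow_add in I.
    assert (P : 0 <= (/ 2) ^ n) by (apply pow_le; lra).
    assert (Q : 0 <= G ^ l) by now apply pow_le.
    assert (Z : 0 <= (/ 2) ^ n * (D * G ^ l)) by (repeat apply Rmult_le_pos; auto).
    apply Rmult_le_compat_l with (r := q) in I; [|lra].
    replace (q * (2 * C + (/ 2) ^ n * (D * (G ^ l * G ^ m)))) with
      (q * (2 * C) + (q * G ^ m) * ((/ 2) ^ n * (D * G ^ l))) in I by ring.
    simpl pow. generalize (Rmult_le_compat_r _ _ _ Z hqG). nra. }
intros l.
assert (L : is_lim_seq (fun n => 2 * C + (/ 2) ^ n * (D * G ^ l)) (2 * C + 0 * (D * G ^ l))).
{ apply is_lim_seq_plus'; [apply is_lim_seq_const|].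
  apply is_lim_seq_mult'; [|apply is_lim_seq_const].
  apply is_lim_seq_geom. rewrite Rabs_pos_eq; lra. }
rewrite Rmult_0_l, Rplus_0_r in L.
apply (is_lim_seq_le _ _ (f l) (2 * C) (fun n => it n l) (is_lim_seq_const _) L).
Qed.

Lemma RInt_exp (c a b : R) : c <> 0 ->
  RInt (fun s => exp (c * s)) a b = (exp (c * b) - exp (c * a)) / c.
Proof.
intros hc. apply is_RInt_unique.
replace ((exp (c * b) - exp (c * a)) / c) with
  (minus (exp (c * b) / c) (exp (c * a) / c))
  by (unfold minus, plus, opp; simpl; field; exact hc).
apply (is_RInt_derive (fun s => exp (c * s) / c)).
- intros s _. auto_derive; [exact I|]. field; exact hc.
- intros s _. apply (ex_derive_continuous (fun s => exp (c * s))). auto_derive. exact I.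
Qed.

(** * Bounded operators, resolvents and limits *)

Section Operators.
Context {H : HilbertSpace}.
Implicit Types (x y : H) (S : R -> H -> H) (A : H -> H -> Prop).

Lemma norm_zero_eq : norm (@zero H) = 0.
Proof. exact (@norm_zero _ H). Qed.

Lemma norm_triangle_H x y : norm (plus x y) <= norm x + norm y.
Proof. exact (norm_triangle x y). Qed.

Lemma norm_RtoC_scal (c : R) x : norm (scal (RtoC c) x : H) = Rabs c * norm x.
Proof. now rewrite norm_scal_eq, Cmod_R. Qed.

Lemma linear_opp (T : H -> H) x : is_linear T -> T (opp x) = opp (T x).
Proof. intros lT. rewrite !oppE. apply lT. Qed.

Lemma linear_minus (T : H -> H) x y :
  is_linear T -> T (minus x y) = minus (T x) (T y).
Proof.
intros lT. unfold minus. rewrite <- (linear_opp T y lT). apply lT.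
Qed.

Lemma linear_lipschitz (T : H -> H) c x p :
  is_linear T -> (forall z, norm (T z) <= c * norm z) ->
  norm (T x) <= norm (T p) + c * norm (minus p x).
Proof.
intros lT hT. generalize (norm_triangle_minus (T x) (T p)) (hT (minus x p)).
rewrite (linear_minus T x p lT), (norm_minus_sym p x). lra.
Qed.

Lemma linear_zero (T : H -> H) : is_linear T -> T zero = zero.
Proof.
intros lT. transitivity (T (scal (RtoC 0) zero)); [now rewrite scal0|].
transitivity (scal (RtoC 0) (T zero)); [apply lT|apply scal0].
Qed.

(** For a bounded operator the supremum defining [op_norm] is finite, so its
    projection to R loses nothing. *)
Lemma norm_le_op_norm (T : H -> H) x :
  is_linear T -> norm (T x) <= op_norm T * norm x.
Proof.
intros lT.
destruct (linear_norm T lT) as [B [B0 hB]].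
assert (fin : forall y, norm y <= 1 -> norm (T y) <= op_norm T).
{ intros y hy. unfold op_norm.
  set (E := fun v => _). destruct (Lub_Rbar_correct E) as [ub lub].
  assert (h1 : Rbar_le (norm (T y)) (Lub_Rbar E)) by (apply ub; now exists y).
  assert (h2 : Rbar_le (Lub_Rbar E) B).
  { apply lub. intros v [u [hu ->]]. simpl.
    eapply Rle_trans; [apply hB|]. nra. }
  destruct (Lub_Rbar E); simpl in *; tauto. }
destruct (Req_dec (norm x) 0) as [x0|x0].
- assert (h := hB x). rewrite x0 in *. lra.
- assert (px : 0 < norm x) by (generalize (norm_ge_0 x); lra).
  assert (ix : 0 < / norm x) by now apply Rinv_0_lt_compat.
  assert (h := fin (scal (RtoC (/ norm x)) x)).
  replace (T (scal (RtoC (/ norm x)) x)) with (scal (RtoC (/ norm x)) (T x) : H) in h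
    by (symmetry; apply lT).
  rewrite !norm_RtoC_scal, Rabs_pos_eq in h by lra.
  rewrite Rinv_l in h by lra.
  apply Rmult_le_reg_l with (1 := ix).
  replace (/ norm x * (op_norm T * norm x)) with (op_norm T) by (field; lra).
  apply h; lra.
Qed.

Lemma op_norm_le (T : H -> H) c :
  0 <= c -> (forall x, norm (T x) <= c * norm x) -> op_norm T <= c.
Proof.
intros c0 hT. unfold op_norm.
set (E := fun v => _). destruct (Lub_Rbar_correct E) as [ub lub].
assert (h2 : Rbar_le (Lub_Rbar E) c).
{ apply lub. intros v [u [hu ->]]. simpl.
  eapply Rle_trans; [apply hT|]. nra. }
destruct (Lub_Rbar E); simpl in *; tauto.
Qed.

Lemma resolvent_coercive A (w : R) :
  (forall z : C, w <= Re z -> resolvent_set A z) ->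
  is_finite (resolvent_sup A w) ->
  coercive_on_half_plane A w (real (resolvent_sup A w)).
Proof.
intros ex fin z x x' hz hA.
destruct (ex z hz) as [Q hQ]. assert (hQ' := hQ). destruct hQ' as [lQ [_ inv]].
rewrite <- (inv x x' hA) at 1.
eapply Rle_trans; [apply norm_le_op_norm; exact lQ|].
apply Rmult_le_compat_r; [apply norm_ge_0|].
revert fin. unfold resolvent_sup, Rbar_lub.
destruct (Rbar_ex_lub _) as [l [ub lub]]; simpl; intros fin.
assert (h : Rbar_le (op_norm Q) l).
{ apply ub. exists z; split; [exact hz|]. left. now exists Q. }
rewrite <- fin in h. exact h.
Qed.

Lemma generator_eps S x y : generator S x y <->
  forall e, 0 < e -> exists d, 0 < d /\ forall h, 0 < h < d ->
    norm (minus (scal (RtoC (/ h)) (minus (S h x) x) : H) y) < e.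
Proof.
unfold generator. rewrite (filterlim_locally_ball_norm (U := H)). split.
- intros hl e he. destruct (hl (mkposreal e he)) as [d hd].
  exists d; split; [apply cond_pos|]. intros h [h0 h1].
  apply (hd h); [|exact h0]. 
  unfold ball; simpl. unfold AbsRing_ball, abs, minus, plus, opp; simpl.
  rewrite Rabs_pos_eq; lra.
- intros hl e. destruct (hl e (cond_pos e)) as [d [d0 hd]].
  exists (mkposreal d d0). intros h hb h0. apply hd. split; [exact h0|].
  revert hb. unfold ball; simpl. unfold AbsRing_ball, abs, minus, plus, opp; simpl.
  unfold Rabs; destruct Rcase_abs; lra.
Qed.

Lemma orbit_continuous_eps S x t : C0_semigroup S -> 0 <= t ->
  forall e, 0 < e -> exists d, 0 < d /\ forall s, 0 <= s -> Rabs (s - t) < d ->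
    norm (minus (S s x) (S t x)) < e.
Proof.
intros hS ht e he.
assert (hl := C0_continuous S hS x t ht).
destruct (proj1 (filterlim_locally_ball_norm (U := H) (fun s => S s x) (S t x))
            hl (mkposreal e he)) as [d hd].
exists d; split; [apply cond_pos|]. intros s hs hst. now apply (hd s).
Qed.

End Operators.

(** * The generator and damped semigroups *)

Section Semigroup.
Context {H : HilbertSpace}.
Implicit Types (x y : H) (S : R -> H -> H) (A : H -> H -> Prop).

Lemma generator_linear S : C0_semigroup S -> linear_relation (generator S).
Proof.
intros hS. split.
- apply generator_eps. intros e he. exists 1; split; [lra|]. intros h hh.
  replace (S h zero) with (@zero H)
    by (symmetry; refine (linear_zero (S h) _); apply (C0_bounded S hS); lra).
  replace (minus _ _ : H) with (@zero H) by (vec_eq; ring).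
  now rewrite norm_zero_eq.
- intros x x' y y' hx hy. rewrite generator_eps in hx, hy |- *.
  intros e he.
  destruct (hx (e / 2) ltac:(lra)) as [d1 [p1 h1]].
  destruct (hy (e / 2) ltac:(lra)) as [d2 [p2 h2]].
  exists (Rmin d1 d2); split; [now apply Rmin_pos|]. intros h hh.
  generalize (Rmin_l d1 d2) (Rmin_r d1 d2); intros m1 m2.
  specialize (h1 h ltac:(lra)). specialize (h2 h ltac:(lra)).
  replace (S h (plus x y)) with (plus (S h x) (S h y))
    by (symmetry; apply (C0_bounded S hS h); lra).
  replace (minus _ _ : H) with
    (plus (minus (scal (RtoC (/ h)) (minus (S h x) x) : H) x')
          (minus (scal (RtoC (/ h)) (minus (S h y) y) : H) y'))
    by (vec_eq; ring).
  eapply Rle_lt_trans; [apply norm_triangle_H|]. lra.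
- intros k x x' hx. rewrite generator_eps in hx |- *. intros e he.
  assert (k0 := Cmod_ge_0 k).
  destruct (hx (e / (Cmod k + 1))) as [d [p hd]];
    [apply Rdiv_lt_0_compat; lra|].
  exists d; split; [exact p|]. intros h hh. specialize (hd h hh).
  replace (S h (scal k x)) with (scal k (S h x) : H)
    by (symmetry; apply (C0_bounded S hS h); lra).
  replace (minus _ _ : H) with
    (scal k (minus (scal (RtoC (/ h)) (minus (S h x) x) : H) x') : H)
    by (vec_eq; ring).
  rewrite norm_scal_eq.
  apply Rmult_lt_compat_l with (r := Cmod k + 1) in hd; [|lra].
  replace ((Cmod k + 1) * (e / (Cmod k + 1))) with e in hd by (field; lra).
  revert hd. set (N := norm _). intros hd.
  assert (0 <= N) by apply norm_ge_0. nra.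
Qed.

Lemma generator_orbit S x y t : C0_semigroup S -> 0 <= t ->
  generator S x y -> generator S (S t x) (S t y).
Proof.
intros hS ht hx. rewrite generator_eps in hx |- *. intros e he.
assert (lT := C0_bounded S hS t ht).
destruct (linear_norm _ lT) as [B [B0 hB]].
destruct (hx (e / B)) as [d [p hd]]; [apply Rdiv_lt_0_compat; lra|].
exists d; split; [exact p|]. intros h hh. specialize (hd h hh).
replace (S h (S t x)) with (S t (S h x)).
2:{ rewrite <- !(C0_add S hS) by lra. f_equal. ring. }
replace (minus _ _ : H) with
  (S t (minus (scal (RtoC (/ h)) (minus (S h x) x) : H) y)).
- eapply Rle_lt_trans; [apply hB|].
  apply Rmult_lt_compat_l with (r := B) in hd; [|lra].
  replace (B * (e / B)) with e in hd by (field; lra). exact hd.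
- rewrite (linear_minus (S t) _ _ lT).
  replace (S t (scal (RtoC (/ h)) (minus (S h x) x)))
    with (scal (RtoC (/ h)) (S t (minus (S h x) x)) : H) by (symmetry; apply lT).
  now rewrite (linear_minus (S t) _ _ lT).
Qed.

(** Every x is z u - A u for some u in the domain, and A u is the limit of
    (S h u - u)/h, which belongs to the domain.  So x is a limit of elements of
    the domain. *)
Lemma generator_dense S (z : C) : C0_semigroup S ->
  resolvent_set (generator S) z ->
  forall x e, 0 < e -> exists p p', generator S p p' /\ norm (minus p x) < e.
Proof.
intros hS [Q [_ [right_inv _]]] x e he.
destruct (right_inv x) as [y' [hA eqx]].
assert (lin := generator_linear S hS).
assert (hA' := hA). rewrite generator_eps in hA'.
destruct (hA' e he) as [d [d0 hd]].
set (h := d / 2). specialize (hd h ltac:(unfold h; lra)).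
set (u := Q x) in *.
exists (plus (scal z u) (scal (RtoC (- / h)) (plus (S h u) (scal (- RtoC 1)%C u)))).
exists (plus (scal z y') (scal (RtoC (- / h)) (plus (S h y') (scal (- RtoC 1)%C y')))).
split.
- repeat (apply (lr_plus _ lin) || apply (lr_scal _ lin)); try exact hA.
  apply generator_orbit; [exact hS|unfold h; lra|exact hA].
- rewrite norm_minus_sym.
  replace (minus x _) with (minus (scal (RtoC (/ h)) (minus (S h u) u) : H) y');
    [exact hd|].
  assert (eqx' : minus (scal z u : H) y' = x) by exact eqx. rewrite <- eqx'.
  vec_eq. rewrite RtoC_opp. ring.
Qed.

Definition damped (c : R) S (t : R) x : H := scal (RtoC (exp (c * t))) (S t x).

Lemma damped_semigroup c S : C0_semigroup S -> C0_semigroup (damped c S).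
Proof.
intros hS. split.
- intros t ht. assert (lT := C0_bounded S hS t ht). split.
  + intros x y. unfold damped. rewrite (linear_plus _ lT). apply scalDl.
  + intros k x. unfold damped. rewrite (linear_scal _ lT).
    transitivity (scal (RtoC (exp (c * t)) * k)%C (S t x)); [apply scalA|].
    rewrite Cmult_comm. symmetry; apply scalA.
  + destruct (linear_norm _ lT) as [B [B0 hB]].
    assert (pe := exp_pos (c * t)).
    exists (exp (c * t) * B). split; [now apply Rmult_lt_0_compat|].
    intros x. unfold damped.
    eapply Rle_trans; [apply Req_le, norm_RtoC_scal|].
    rewrite Rabs_pos_eq, Rmult_assoc by lra.
    apply Rmult_le_compat_l; [lra|apply hB].
- intros x. unfold damped. rewrite Rmult_0_r, exp_0, scal1. apply (C0_zero S hS).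
- intros s t x hs ht. unfold damped.
  rewrite (C0_add S hS) by assumption.
  replace (S s (scal (RtoC (exp (c * t))) (S t x)))
    with (scal (RtoC (exp (c * t))) (S s (S t x)) : H)
    by (symmetry; apply (C0_bounded S hS s hs)).
  rewrite scalA, Rmult_plus_distr_l, exp_plus, RtoC_mult. reflexivity.
- intros x t ht.
  apply (filterlim_locally_ball_norm (U := H) (fun s => damped c S s x)).
  intros e. assert (he := cond_pos e).
  assert (pn := norm_ge_0 (S t x)).
  assert (pe := exp_pos (c * t)).
  set (e2 := e / (2 * (norm (S t x) + 1))).
  assert (he2 : 0 < e2) by (apply Rdiv_lt_0_compat; lra).
  assert (ce : continuous (fun s => exp (c * s)) t)
    by (apply (ex_derive_continuous (fun s => exp (c * s))); auto_derive; exact I).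
  assert (ce' := proj1 (filterlim_locally _ _) ce).
  destruct (ce' (mkposreal _ (Rmin_pos 1 e2 ltac:(lra) he2))) as [d1 h1].
  destruct (orbit_continuous_eps S x t hS ht (e / (2 * (exp (c * t) + 1)))
    ltac:(apply Rdiv_lt_0_compat; lra)) as [d2 [p2 h2]].
  exists (mkposreal _ (Rmin_pos d1 d2 (cond_pos d1) p2)). intros s hs s0.
  assert (hs' : Rabs (s - t) < Rmin d1 d2) by exact hs.
  generalize (Rmin_l d1 d2) (Rmin_r d1 d2); intros m1 m2.
  specialize (h1 s ltac:(apply (Rlt_le_trans _ _ _ hs' m1))).
  specialize (h2 s s0 ltac:(lra)).
  assert (h1' : Rabs (exp (c * s) - exp (c * t)) < Rmin 1 e2) by exact h1.
  generalize (Rmin_l 1 e2) (Rmin_r 1 e2); intros m3 m4.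
  unfold ball_norm, damped.
  set (E := exp (c * s)) in *. set (F := exp (c * t)) in *.
  change (norm (minus (scal (RtoC E) (S s x) : H) (scal (RtoC F) (S t x)) : H) < e).
  replace (minus _ _ : H) with
    (plus (scal (RtoC E) (minus (S s x) (S t x))) (scal (RtoC (E - F)) (S t x)) : H)
    by (rewrite RtoC_minus; vec_eq; ring).
  eapply Rle_lt_trans; [apply norm_triangle_H|].
  rewrite !norm_RtoC_scal.
  assert (pE : 0 < E) by apply exp_pos.
  assert (bE : E <= F + 1).
  { revert h1'. unfold Rabs; destruct Rcase_abs; lra. }
  rewrite (Rabs_pos_eq E) by lra.
  assert (i1 : E * norm (minus (S s x) (S t x)) <= (F + 1) * norm (minus (S s x) (S t x)))
    by (apply Rmult_le_compat_r; [apply norm_ge_0|exact bE]).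
  apply Rmult_lt_compat_l with (r := F + 1) in h2; [|lra].
  replace ((F + 1) * (e / (2 * (F + 1)))) with (e / 2) in h2 by (field; lra).
  assert (i2 : Rabs (E - F) * norm (S t x) <= e2 * (norm (S t x) + 1)).
  { apply Rmult_le_compat; try apply Rabs_pos; lra. }
  replace (e2 * (norm (S t x) + 1)) with (e / 2) in i2 by (unfold e2; field; lra).
  lra.
Qed.

(** Stated for any S' equal to exp(c t) S(t) pointwise rather than for
    [damped c S], so that it also applies to undo a damping. *)
Lemma generator_damped S S' c x y : C0_semigroup S ->
  (forall t u, S' t u = scal (RtoC (exp (c * t))) (S t u)) ->
  generator S x y -> generator S' x (plus y (scal (RtoC c) x)).
Proof.
intros hS hS' hx. rewrite generator_eps in hx |- *. intros e he.
assert (px := norm_ge_0 x). assert (py := norm_ge_0 y).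
set (k := e / (3 + norm x + norm y)).
assert (hk : 0 < k) by (apply Rdiv_lt_0_compat; lra).
destruct (hx k hk) as [d1 [p1 h1]].
assert (ce : continuous (fun s => exp (c * s)) 0)
    by (apply (ex_derive_continuous (fun s => exp (c * s))); auto_derive; exact I).
destruct (proj1 (filterlim_locally _ _) ce
  (mkposreal _ (Rmin_pos 1 k ltac:(lra) hk))) as [d2 h2].
assert (de : is_derive (fun s => exp (c * s)) 0 c).
{ auto_derive; [exact I|]. rewrite Rmult_0_r, exp_0. ring. }
apply is_derive_Reals in de. destruct (de k hk) as [d3 h3].
exists (Rmin d1 (Rmin d2 d3)).
generalize (Rmin_l d1 (Rmin d2 d3)) (Rmin_r d1 (Rmin d2 d3)) (Rmin_l d2 d3)
  (Rmin_r d2 d3); intros m1 m2 m3 m4.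
split.
{ apply Rmin_pos; [exact p1|]. apply Rmin_pos; apply cond_pos. }
intros h hh.
specialize (h1 h ltac:(lra)).
assert (h2' : Rabs (exp (c * h) - exp (c * 0)) < Rmin 1 k).
{ apply (h2 h). change (Rabs (h - 0) < d2). rewrite Rabs_pos_eq; lra. }
specialize (h3 h ltac:(lra) ltac:(rewrite Rabs_pos_eq; lra)).
rewrite Rplus_0_l, Rmult_0_r, exp_0 in h3. rewrite Rmult_0_r, exp_0 in h2'.
generalize (Rmin_l 1 k) (Rmin_r 1 k); intros m5 m6.
rewrite hS'. set (E := exp (c * h)) in *.
assert (pE : 0 < E) by apply exp_pos.
assert (bE : E <= 2).
{ revert h2'. unfold Rabs; destruct Rcase_abs; lra. }
replace (minus _ _ : H) with
  (plus (scal (RtoC E) (minus (scal (RtoC (/ h)) (minus (S h x) x) : H) y))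
    (plus (scal (RtoC (E - 1)) y) (scal (RtoC ((E - 1) / h - c)) x)) : H).
2:{ unfold Rdiv. rewrite !RtoC_minus, RtoC_mult, RtoC_minus. vec_eq. ring. }
eapply Rle_lt_trans; [apply norm_triangle_H|].
eapply Rle_lt_trans; [apply Rplus_le_compat_l, norm_triangle_H|].
rewrite !norm_RtoC_scal. rewrite (Rabs_pos_eq E) by lra.
assert (i1 : E * norm (minus (scal (RtoC (/ h)) (minus (S h x) x) : H) y) <= 2 * k).
{ apply Rmult_le_compat; try lra. apply norm_ge_0. }
assert (i2 : Rabs (E - 1) * norm y <= k * norm y)
  by (apply Rmult_le_compat_r; lra).
assert (i3 : Rabs ((E - 1) / h - c) * norm x <= k * norm x)
  by (apply Rmult_le_compat_r; lra).
assert (ke : k * (3 + norm x + norm y) = e) by (unfold k; field; lra).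
lra.
Qed.

(** Damping by exp(-s t) shifts the generator by -s, hence moves the half-plane
    Re z >= s, contained in Re z >= w, to Re z >= 0. *)
Lemma damped_coercive S (w s K : R) : C0_semigroup S ->
  coercive_on_half_plane (generator S) w K -> w <= s ->
  coercive_on_half_plane (generator (damped (- s) S)) 0 K.
Proof.
intros hS hK hws z x x' hz hA.
assert (hA' : generator S x (plus x' (scal (RtoC s) x))).
{ apply (generator_damped (damped (- s) S)); [now apply damped_semigroup| |exact hA].
  intros t u. unfold damped. rewrite scalA, <- RtoC_mult, <- exp_plus.
  replace (s * t + - s * t) with 0 by ring. now rewrite exp_0, scal1. }
assert (hz' : w <= Re (z + RtoC s)%C) by (destruct z; simpl in *; lra).
assert (B := hK _ _ _ hz' hA').
replace (minus (scal z x : H) x' : H) with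
  (minus (scal (z + RtoC s)%C x : H) (plus x' (scal (RtoC s) x))); [exact B|].
vec_eq. ring.
Qed.

End Semigroup.

(** * The sampled orbit with a cutoff *)

Section Cutoff.
Context {H : HilbertSpace}.
Implicit Types (x y : H) (S : R -> H -> H) (A : H -> H -> Prop).

(** The local error of the implicit Euler scheme on the exact orbit, divided by
    the step. *)
Definition difference_defect S x y (h : R) : H :=
  minus (scal (RtoC (/ h)) (minus (S h x) x) : H) (S h y).

(** Both terms of the defect tend to y: the first because x is in the domain,
    the second by strong continuity. *)
Lemma difference_defect_lim S x y a : C0_semigroup S -> generator S x y -> 0 < a ->
  is_lim_seq (fun n => norm (difference_defect S x y (mesh a n))) 0.
Proof.
intros hS hx ha. apply is_lim_seq_Reals. intros e he.
rewrite generator_eps in hx.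
destruct (hx (e / 2) ltac:(lra)) as [d1 [p1 h1]].
destruct (orbit_continuous_eps S y 0 hS (Rle_refl 0) (e / 2) ltac:(lra))
  as [d2 [p2 h2]].
destruct (proj1 (is_lim_seq_Reals _ _) (mesh_lim a) (Rmin d1 d2)
  (Rmin_pos _ _ p1 p2)) as [N hN].
exists N. intros n hn. assert (hm := hN n hn). unfold R_dist in *.
assert (mp := mesh_pos a n ha). set (h := mesh a n) in *.
assert (m1 := Rmin_l d1 d2). assert (m2 := Rmin_r d1 d2).
rewrite Rminus_0_r in hm |- *. rewrite Rabs_pos_eq in hm by lra.
rewrite Rabs_pos_eq by apply norm_ge_0.
specialize (h1 h ltac:(lra)).
specialize (h2 h ltac:(lra) ltac:(rewrite Rminus_0_r, Rabs_pos_eq; lra)).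
rewrite (C0_zero S hS) in h2.
unfold difference_defect.
replace (minus _ _ : H) with
  (plus (minus (scal (RtoC (/ h)) (minus (S h x) x) : H) y) (minus y (S h y)))
  by (vec_eq; ring).
eapply Rle_lt_trans; [apply norm_triangle_H|].
rewrite (norm_minus_sym y). lra.
Qed.

Lemma cutoff_step (h chi0 chi1 : R) (U UhX UhY : C) : h <> 0 ->
  (RtoC chi1 * UhX)%C =
  (RtoC chi0 * U +
   RtoC h * (RtoC chi1 * UhY + (RtoC ((chi1 - chi0) / h) * U +
     RtoC chi1 * (RtoC (/ h) * (UhX - U) - UhY))))%C.
Proof.
intros h0. unfold Rdiv. rewrite RtoC_mult, RtoC_minus, RtoC_inv by exact h0.
field. intros e; now apply RtoC_inj in e.
Qed.

(** The sequence chi_j S(jh) x solves the Euler scheme with a right-hand side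
    consisting of the commutator with the cutoff, (chi_(j+1) - chi_j)/h S(jh) x,
    and of the propagated defect. *)
Lemma discrete_cutoff S x y K (h : R) n (chi : nat -> R) :
  C0_semigroup S -> coercive_on_half_plane (generator S) 0 K -> 0 <= K ->
  generator S x y -> 0 < h -> chi O = 0 ->
  (forall j, (n <= j)%nat -> chi j = 0) ->
  sum_lt (fun j => chi j ^ 2 * norm (S (INR j * h) x) ^ 2) n <=
  K ^ 2 * sum_lt (fun j =>
    (Rabs ((chi (j + 1)%nat - chi j) / h) * norm (S (INR j * h) x) +
     Rabs (chi (j + 1)%nat) * norm (S (INR j * h) (difference_defect S x y h))) ^ 2) n.
Proof.
intros hS hK K0 hx hh chi0 supp.
assert (tp : forall j, 0 <= INR j * h)
  by (intros j; apply Rmult_le_pos; [apply pos_INR|lra]).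
set (w := fun j => scal (RtoC (chi j)) (S (INR j * h) x) : H).
set (v := fun j => scal (RtoC (chi j)) (S (INR j * h) y) : H).
set (g := fun j => plus (scal (RtoC ((chi (j + 1)%nat - chi j) / h)) (S (INR j * h) x))
  (scal (RtoC (chi (j + 1)%nat)) (S (INR j * h) (difference_defect S x y h))) : H).
assert (E : sum_lt (fun j => norm (w j) ^ 2) n <=
            K ^ 2 * sum_lt (fun j => norm (g j) ^ 2) n).
{ apply (euler_energy (generator S) K h n w v g); auto.
  - now apply generator_linear.
  - intros j. unfold w, v. apply (lr_scal _ (generator_linear S hS)).
    now apply generator_orbit.
  - unfold w. rewrite chi0. apply scal0.
  - unfold v. rewrite chi0. apply scal0.
  - intros j hj. unfold w, v, g. rewrite !supp by lia.
    rewrite Rminus_0_r. unfold Rdiv. rewrite Rmult_0_l, !scal0.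
    repeat split. apply plus_zero_l.
  - intros j. unfold w, v, g, difference_defect. rewrite Nat.add_1_r, S_INR.
    replace ((INR j + 1) * h) with (INR j * h + h) by ring.
    rewrite !(C0_add S hS) by (auto; lra).
    assert (lT := C0_bounded S hS _ (tp j)).
    rewrite (linear_minus _ _ _ lT).
    replace (S (INR j * h) (scal (RtoC (/ h)) (minus (S h x) x))) with
      (scal (RtoC (/ h)) (S (INR j * h) (minus (S h x) x)) : H)
      by (symmetry; apply lT).
    rewrite (linear_minus _ _ _ lT).
    vec_eq. apply cutoff_step. lra. }
replace (sum_lt (fun j => chi j ^ 2 * norm (S (INR j * h) x) ^ 2) n)
  with (sum_lt (fun j => norm (w j) ^ 2) n).
2:{ apply sum_lt_Rext. intros j _. unfold w. rewrite norm_RtoC_scal.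
    rewrite Rpow_mult_distr, <- Rsqr_pow2, <- Rsqr_abs, Rsqr_pow2. reflexivity. }
eapply Rle_trans; [exact E|].
apply Rmult_le_compat_l; [apply pow_le, K0|].
apply sum_lt_le. intros j _. apply pow_incr. split; [apply norm_ge_0|].
unfold g. eapply Rle_trans; [apply norm_triangle_H|].
now rewrite !norm_RtoC_scal.
Qed.

End Cutoff.


Section Trapezoid.
Context (psi : nat -> R) (h : R) (P L M : nat) (M_pos : (0 < M)%nat).

(** A cutoff that rises with slopes psi during P steps of size h, is constant
    during L steps and decreases linearly to 0 during M steps. *)
Definition trapezoid (j : nat) : R :=
  if (j <=? P)%nat then h * sum_lt psi j
  else if (j <=? P + L)%nat then h * sum_lt psi P
  else if (j <=? P + L + M)%nat then
    h * sum_lt psi P * (1 - INR (j - (P + L)) / INR M)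
  else 0.

Lemma trapezoid_0 : trapezoid 0 = 0.
Proof. apply Rmult_0_r. Qed.

Lemma trapezoid_rise j : (j < P)%nat ->
  trapezoid (j + 1) - trapezoid j = h * psi j.
Proof.
intros hj. unfold trapezoid.
rewrite !(proj2 (Nat.leb_le _ _)) by lia.
rewrite Nat.add_1_r. simpl sum_lt. unfold plus; simpl. ring.
Qed.

Lemma trapezoid_plateau j : (j <= L)%nat -> trapezoid (P + j) = h * sum_lt psi P.
Proof.
intros hj. unfold trapezoid.
destruct (Nat.leb_spec (P + j) P) as [h1|h1].
- now replace (P + j)%nat with P by lia.
- now rewrite (proj2 (Nat.leb_le _ _)) by lia.
Qed.

Lemma trapezoid_fall i : (i <= M)%nat ->
  trapezoid (P + L + i) = h * sum_lt psi P * (1 - INR i / INR M).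
Proof.
intros hi. assert (M0 : INR M <> 0) by (apply not_0_INR; lia).
destruct (Nat.eq_dec i 0) as [->|i0].
- rewrite Nat.add_0_r, trapezoid_plateau by lia. simpl. field. exact M0.
- unfold trapezoid.
  rewrite !(proj2 (Nat.leb_gt _ _)) by lia.
  rewrite (proj2 (Nat.leb_le _ _)) by lia.
  now replace (P + L + i - (P + L))%nat with i by lia.
Qed.

Lemma trapezoid_end j : (P + L + M <= j)%nat -> trapezoid j = 0.
Proof.
intros hj. assert (M0 : INR M <> 0) by (apply not_0_INR; lia).
destruct (Nat.eq_dec j (P + L + M)) as [->|j0].
- rewrite trapezoid_fall by lia. field. exact M0.
- unfold trapezoid. now rewrite !(proj2 (Nat.leb_gt _ _)) by lia.
Qed.

Lemma trapezoid_bound D j : 0 <= h -> 0 <= D ->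
  (forall i, (i < P)%nat -> Rabs (psi i) <= D) ->
  Rabs (trapezoid j) <= h * (INR P * D).
Proof.
intros hh D0 hpsi.
assert (part : forall k, (k <= P)%nat -> Rabs (h * sum_lt psi k) <= h * (INR P * D)).
{ intros k hk. rewrite Rabs_mult, (Rabs_pos_eq h) by exact hh.
  apply Rmult_le_compat_l; [exact hh|].
  apply Rle_trans with (INR k * D).
  2:{ apply Rmult_le_compat_r; [exact D0|]. now apply le_INR. }
  induction k as [|k IH].
  - simpl. unfold zero; simpl. rewrite Rabs_R0. lra.
  - rewrite S_INR. simpl sum_lt. unfold plus; simpl.
    eapply Rle_trans; [apply Rabs_triang|].
    generalize (IH ltac:(lia)) (hpsi k ltac:(lia)). lra. }
unfold trapezoid.
destruct (Nat.leb_spec j P) as [h1|h1]; [now apply part|].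
destruct (Nat.leb_spec j (P + L)) as [h2|h2]; [now apply part|].
destruct (Nat.leb_spec j (P + L + M)) as [h3|h3].
- rewrite Rabs_mult. rewrite <- (Rmult_1_r (h * (INR P * D))).
  apply Rmult_le_compat; try apply Rabs_pos; [now apply part|].
  assert (M0 : 0 < INR M) by (apply lt_0_INR; lia).
  assert (i0 := pos_INR (j - (P + L))).
  assert (iM : INR (j - (P + L)) <= INR M) by (apply le_INR; lia).
  assert (q0 : 0 <= INR (j - (P + L)) / INR M).
  { apply Rmult_le_pos; [exact i0|]. left. now apply Rinv_0_lt_compat. }
  assert (q1 : INR (j - (P + L)) / INR M <= 1).
  { apply Rmult_le_reg_r with (1 := M0). unfold Rdiv.
    rewrite Rmult_assoc, Rinv_l; lra. }
  rewrite Rabs_pos_eq; lra.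
- rewrite Rabs_R0. apply Rmult_le_pos; [exact hh|].
  apply Rmult_le_pos; [apply pos_INR|exact D0].
Qed.

End Trapezoid.

Section TrapezoidEnergy.
Context {H : HilbertSpace}.
Implicit Types (x y : H) (S : R -> H -> H).

Lemma square_perturbation (d u X e D B E : R) :
  0 <= d <= D -> 0 <= u <= B -> 0 <= X <= E -> 0 <= e ->
  (d * u + X * e) ^ 2 <= d ^ 2 * u ^ 2 + (2 * D * B * E * e + E ^ 2 * e ^ 2).
Proof.
intros hd hu hX he.
assert (a1 : d * u <= D * B) by (apply Rmult_le_compat; lra).
assert (a2 : X * e <= E * e) by (apply Rmult_le_compat_r; lra).
assert (a3 : 0 <= X * e) by (apply Rmult_le_pos; lra).
assert (a0 : 0 <= d * u) by (apply Rmult_le_pos; lra).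
assert (a4 : (d * u) * (X * e) <= (D * B) * (E * e)) by (apply Rmult_le_compat; lra).
assert (a5 : (X * e) ^ 2 <= (E * e) ^ 2) by (apply pow_incr; lra).
replace ((d * u + X * e) ^ 2) with (d ^ 2 * u ^ 2 + 2 * ((d * u) * (X * e)) + (X * e) ^ 2) by ring.
rewrite <- Rpow_mult_distr. nra.
Qed.

(** [discrete_cutoff] for the trapezoid.  Only the plateau is kept on the left;
    on the right the defect enters through an error bounded at each of the
    P + L + M points, which stays negligible after multiplication by h since
    h (P + L + M) is the length of the time interval. *)
Lemma discrete_trapezoid S x y K B D (h : R) (psi : nat -> R) (P L M : nat) :
  C0_semigroup S -> coercive_on_half_plane (generator S) 0 K -> 0 <= K ->
  generator S x y -> 0 < h -> (0 < M)%nat -> 0 <= D -> 0 <= B ->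
  (forall i, (i < P)%nat -> Rabs (psi i) <= D) ->
  (forall j z, (j < P + L + M)%nat -> norm (S (INR j * h) z) <= B * norm z) ->
  let b j := norm (S (INR j * h) x) ^ 2 in
  let s := h * sum_lt psi P in
  let E := h * (INR P * D) in
  let D' := D + E / (INR M * h) in
  let e := B * norm (difference_defect S x y h) in
  s ^ 2 * sum_lt (fun i => b (P + i)%nat) L <=
  K ^ 2 * (sum_lt (fun i => psi i ^ 2 * b i) P +
           (s / (INR M * h)) ^ 2 * sum_lt (fun i => b (P + L + i)%nat) M +
           INR (P + L + M) *
             (2 * D' * (B * norm x) * E * e + E ^ 2 * e ^ 2)).
Proof.
intros hS hK K0 hx hh hM D0 B0 hpsi hB b s E D' e.
assert (M0 : 0 < INR M) by (apply lt_0_INR; lia).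
assert (Mh : 0 < INR M * h) by now apply Rmult_lt_0_compat.
assert (E0 : 0 <= E).
{ apply Rmult_le_pos; [lra|]. apply Rmult_le_pos; [apply pos_INR|exact D0]. }
set (chi := trapezoid psi h P L M).
assert (chiE : forall j, Rabs (chi j) <= E).
{ intros j. apply trapezoid_bound; auto. lra. }
assert (sE : Rabs s <= E).
{ generalize (chiE (P + 0)%nat). unfold chi. now rewrite trapezoid_plateau by lia. }
assert (EM : 0 <= E / (INR M * h)).
{ apply Rmult_le_pos; [exact E0|]. left. now apply Rinv_0_lt_compat. }
assert (F := discrete_cutoff S x y K h (P + L + M) chi hS hK K0 hx hh
  (trapezoid_0 psi h P L M) (trapezoid_end psi h P L M hM)).
fold b in F.
set (d := fun j => Rabs ((chi (j + 1)%nat - chi j) / h)) in *.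
assert (d1 : forall i, (i < P)%nat -> d i = Rabs (psi i)).
{ intros i hi. unfold d, chi. rewrite trapezoid_rise by lia.
  f_equal. field. lra. }
assert (d2 : forall i, (i < L)%nat -> d (P + i)%nat = 0).
{ intros i hi. unfold d, chi.
  rewrite <- Nat.add_assoc, !trapezoid_plateau by lia.
  replace (_ / h) with 0 by (field; lra). apply Rabs_R0. }
assert (d3 : forall i, (i < M)%nat -> d (P + L + i)%nat = Rabs (s / (INR M * h))).
{ intros i hi. unfold d, chi.
  rewrite <- Nat.add_assoc, !trapezoid_fall by lia.
  fold s. rewrite <- (Rabs_Ropp (s / _)). f_equal.
  rewrite plus_INR. simpl. field. split; lra. }
assert (dD : forall j, (j < P + L + M)%nat -> 0 <= d j <= D').
{ intros j hj. split; [apply Rabs_pos|]. unfold D'.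
  destruct (Nat.lt_ge_cases j P) as [h1|h1].
  - rewrite d1 by exact h1. generalize (hpsi j h1). lra.
  - destruct (Nat.lt_ge_cases j (P + L)) as [h2|h2].
    + replace j with (P + (j - P))%nat by lia. rewrite d2 by lia. lra.
    + replace j with (P + L + (j - (P + L)))%nat by lia. rewrite d3 by lia.
      unfold Rdiv at 1. rewrite Rabs_mult, Rabs_inv, (Rabs_pos_eq (INR M * h)) by lra.
      assert (Rabs s * / (INR M * h) <= E * / (INR M * h)); [|unfold Rdiv; lra].
      apply Rmult_le_compat_r; [|exact sE]. left. now apply Rinv_0_lt_compat. }
assert (e0 : 0 <= e) by (apply Rmult_le_pos; [exact B0|apply norm_ge_0]).
set (c := 2 * D' * (B * norm x) * E * e + E ^ 2 * e ^ 2).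
assert (U : sum_lt (fun j => (d j * norm (S (INR j * h) x) + Rabs (chi (j + 1)%nat) *
   norm (S (INR j * h) (difference_defect S x y h))) ^ 2) (P + L + M) <=
  sum_lt (fun j => d j ^ 2 * b j + c) (P + L + M)).
{ apply sum_lt_le. intros j hj.
  eapply Rle_trans; [|apply square_perturbation; auto].
  - apply pow_incr. split.
    + apply Rplus_le_le_0_compat; apply Rmult_le_pos; try apply Rabs_pos; apply norm_ge_0.
    + apply Rplus_le_compat_l, Rmult_le_compat_l; [apply Rabs_pos|]. now apply hB.
  - split; [apply norm_ge_0|now apply hB].
  - split; [apply Rabs_pos|apply chiE]. }
rewrite sum_lt_Rplus, sum_lt_const in U.
assert (V : sum_lt (fun j => d j ^ 2 * b j) (P + L + M) =
  sum_lt (fun i => psi i ^ 2 * b i) P +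
  (s / (INR M * h)) ^ 2 * sum_lt (fun i => b (P + L + i)%nat) M).
{ rewrite !sum_lt_Rsplit.
  rewrite (sum_lt_Rext _ (fun i => psi i ^ 2 * b i) P).
  2:{ intros i hi. now rewrite d1, pow2_abs by exact hi. }
  rewrite (sum_lt_Rext _ (fun i => 0 * 0) L).
  2:{ intros i hi. rewrite d2 by exact hi. rewrite pow_i by lia. now rewrite !Rmult_0_l. }
  rewrite (sum_lt_Rext _ (fun i => (s / (INR M * h)) ^ 2 * b (P + L + i)%nat) M).
  2:{ intros i hi. now rewrite d3, pow2_abs by exact hi. }
  rewrite !sum_lt_Rmult, Rmult_0_l, Rplus_0_r. reflexivity. }
rewrite V in U.
assert (W : s ^ 2 * sum_lt (fun i => b (P + i)%nat) L <=
            sum_lt (fun j => chi j ^ 2 * b j) (P + L + M)).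
{ rewrite !sum_lt_Rsplit.
  rewrite (sum_lt_Rext (fun j => chi (P + j)%nat ^ 2 * b (P + j)%nat)
    (fun i => s ^ 2 * b (P + i)%nat) L).
  2:{ intros i hi. unfold chi. now rewrite trapezoid_plateau by lia. }
  rewrite sum_lt_Rmult.
  assert (pos : forall u n, (forall i, 0 <= u i) -> 0 <= sum_lt u n).
  { intros u n hu. rewrite <- (Rmult_0_r (INR n)), <- (sum_lt_const 0 n).
    apply sum_lt_le. intros; apply hu. }
  assert (p1 := pos (fun j => chi j ^ 2 * b j) P
    ltac:(intros; unfold b; apply Rmult_le_pos; apply pow2_ge_0)).
  assert (p2 := pos (fun j => chi (P + L + j)%nat ^ 2 * b (P + L + j)%nat) M
    ltac:(intros; unfold b; apply Rmult_le_pos; apply pow2_ge_0)).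
  lra. }
eapply Rle_trans; [exact W|]. eapply Rle_trans; [exact F|].
apply Rmult_le_compat_l; [apply pow_le, K0|]. exact U.
Qed.

End TrapezoidEnergy.

(** * The energy inequality *)

Section IntegralCutoff.
Context {H : HilbertSpace}.
Implicit Types (x y : H) (S : R -> H -> H).

Definition locally_bounded S : Prop :=
  forall T, exists B, 0 <= B /\
    forall s z, 0 <= s <= T -> norm (S s z) <= B * norm z.

(** The limit of [discrete_trapezoid] as the step tends to 0.  Taking the three
    parts of the cutoff of lengths commensurable with a makes the breakpoints
    mesh points, so each block of the sums is a Riemann sum of a continuous
    function.  The function b extends the squared norm of the orbit to negative
    times, where S is arbitrary. *)
Lemma integral_cutoff S x y K a D (l m : nat) (phi b : R -> R) :
  C0_semigroup S -> locally_bounded S ->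
  coercive_on_half_plane (generator S) 0 K -> 0 <= K ->
  generator S x y -> 0 < a -> (0 < m)%nat -> 0 <= D ->
  (forall s, continuous phi s) -> (forall s, 0 <= s <= a -> Rabs (phi s) <= D) ->
  (forall s, continuous b s) -> (forall s, 0 <= s -> b s = norm (S s x) ^ 2) ->
  let Y := RInt phi 0 a in
  let c := a + INR l * a in
  Y ^ 2 * RInt b a c <=
  K ^ 2 * (RInt (fun s => phi s ^ 2 * b s) 0 a +
           (Y / (INR m * a)) ^ 2 * RInt b c (c + INR m * a)).
Proof.
intros hS hB hK K0 hx ha hm D0 cphi hphi cb hb Y c.
destruct (hB (INR (1 + l + m) * a)) as [B [B0 hB']].
set (h := mesh a).
assert (h0 : forall n, 0 < h n) by (intros n; now apply mesh_pos).
assert (hmul : forall q n, INR (q * Datatypes.S n) * h n = INR q * a)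
  by (intros; apply mesh_mult).
set (sY := fun n => h n * sum_lt (fun i => phi (0 + INR i * h n)) (1 * Datatypes.S n)).
set (s1 := fun n => h n * sum_lt (fun i => b (a + INR i * h n)) (l * Datatypes.S n)).
set (s0 := fun n => h n *
  sum_lt (fun i => phi (0 + INR i * h n) ^ 2 * b (0 + INR i * h n)) (1 * Datatypes.S n)).
set (s2 := fun n => h n * sum_lt (fun i => b (c + INR i * h n)) (m * Datatypes.S n)).
set (r := fun n => norm (difference_defect S x y (h n))).
set (E := a * D).
set (D' := D + E / (INR m * a)).
set (err := fun n => INR (1 + l + m) * a *
  (2 * D' * (B * norm x) * E * (B * r n) + E ^ 2 * (B * r n) ^ 2)).
assert (main : forall n, sY n ^ 2 * s1 n <=
   K ^ 2 * (s0 n + (sY n / (INR m * a)) ^ 2 * s2 n + err n)).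
{ intros n.
  assert (le1 : forall j q, (j <= q * Datatypes.S n)%nat -> INR j * h n <= INR q * a).
  { intros j q hj. rewrite <- (hmul q n). apply Rmult_le_compat_r.
    - left; apply h0.
    - now apply le_INR. }
  assert (jp : forall j, 0 <= INR j * h n).
  { intros j. apply Rmult_le_pos; [apply pos_INR|left; apply h0]. }
  assert (T := discrete_trapezoid S x y K B D (h n) (fun i => phi (0 + INR i * h n))
    (1 * Datatypes.S n) (l * Datatypes.S n) (m * Datatypes.S n)
    hS hK K0 hx (h0 n) ltac:(nia) D0 B0).
  cbv zeta in T.
  rewrite !hmul in T.
  replace (INR (1 * Datatypes.S n + l * Datatypes.S n + m * Datatypes.S n))
    with (INR ((1 + l + m) * Datatypes.S n)) in T by (f_equal; ring).
  replace (h n * (INR (1 * Datatypes.S n) * D)) with E in T.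
  2:{ rewrite (Rmult_comm (INR _)), <- Rmult_assoc, (Rmult_comm (h n)), Rmult_assoc,
      (Rmult_comm (h n)), hmul. unfold E. simpl. ring. }
  fold D' in T.
  assert (T1 := T
    ltac:(intros i hi; apply hphi; rewrite Rplus_0_l; split; [apply jp|];
          rewrite <- (Rmult_1_l a); apply (le1 i 1%nat); lia)
    ltac:(intros j z hj; apply hB'; split; [apply jp|]; apply le1; nia)).
  clear T.
  apply Rmult_le_compat_l with (r := h n) in T1; [|left; apply h0].
  assert (bE : forall p q i, (p = q * Datatypes.S n)%nat ->
      norm (S (INR (p + i) * h n) x) ^ 2 = b (INR q * a + INR i * h n)).
  { intros p q i ->.
    rewrite plus_INR, Rmult_plus_distr_r, hmul. symmetry. apply hb.
    apply Rplus_le_le_0_compat; [|apply jp].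
    apply Rmult_le_pos; [apply pos_INR|lra]. }
  rewrite (sum_lt_Rext (fun i => norm (S (INR (1 * Datatypes.S n + i) * h n) x) ^ 2)
     (fun i => b (a + INR i * h n))) in T1.
  2:{ intros i _. rewrite (bE _ 1%nat) by reflexivity. f_equal. simpl; ring. }
  rewrite (sum_lt_Rext (fun i => norm (S (INR (1 * Datatypes.S n + l * Datatypes.S n + i)
     * h n) x) ^ 2) (fun i => b (c + INR i * h n))) in T1.
  2:{ intros i _. rewrite (bE _ (1 + l)%nat) by ring. f_equal.
      unfold c. rewrite plus_INR. simpl; ring. }
  rewrite (sum_lt_Rext (fun i => phi (0 + INR i * h n) ^ 2 * norm (S (INR i * h n) x) ^ 2)
    (fun i => phi (0 + INR i * h n) ^ 2 * b (0 + INR i * h n))) in T1.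
  2:{ intros i _. rewrite hb by (rewrite Rplus_0_l; apply jp). now rewrite Rplus_0_l. }
  fold (sY n) in T1. fold (r n) in T1.
  unfold s1, s0, s2, err.
  rewrite <- (hmul (1 + l + m)%nat n). nra. }
assert (lY : is_lim_seq sY Y).
{ generalize (riemann_sum_lim phi a 0 1 ha cphi). unfold Y.
  replace (0 + INR 1 * a) with a by (simpl; ring). tauto. }
assert (l1 : is_lim_seq s1 (RInt b a c)) by exact (riemann_sum_lim b a a l ha cb).
assert (l2 : is_lim_seq s2 (RInt b c (c + INR m * a)))
  by exact (riemann_sum_lim b a c m ha cb).
assert (l0 : is_lim_seq s0 (RInt (fun s => phi s ^ 2 * b s) 0 a)).
{ generalize (riemann_sum_lim (fun s => phi s ^ 2 * b s) a 0 1 ha).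
  replace (0 + INR 1 * a) with a by (simpl; ring). intros lim. apply lim.
  intros s. apply (continuous_mult (K := R_AbsRing) (fun s => phi s ^ 2) b); [|apply cb].
  apply (continuous_ext (fun s => phi s * phi s)); [intros; simpl; ring|].
  apply (continuous_mult (K := R_AbsRing) phi phi); apply cphi. }
assert (lr : is_lim_seq r 0) by exact (difference_defect_lim S x y a hS hx ha).
assert (sq : forall u (v : R), is_lim_seq u v -> is_lim_seq (fun n => u n ^ 2) (v ^ 2)).
{ intros u v lu. apply (is_lim_seq_ext (fun n => u n * u n)); [intros; ring|].
  replace (v ^ 2) with (v * v) by ring. now apply is_lim_seq_mult'. }
assert (lBr : is_lim_seq (fun n => B * r n) 0).
{ replace 0 with (B * 0) by ring. apply is_lim_seq_mult'; [apply is_lim_seq_const|exact lr]. }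
assert (lerr : is_lim_seq err 0).
{ replace 0 with (INR (1 + l + m) * a *
     (2 * D' * (B * norm x) * E * 0 + E ^ 2 * 0 ^ 2)) by ring.
  unfold err. apply is_lim_seq_mult'; [apply is_lim_seq_const|].
  apply is_lim_seq_plus'; (apply is_lim_seq_mult'; [apply is_lim_seq_const|]).
  - exact lBr.
  - now apply sq. }
assert (lL : is_lim_seq (fun n => sY n ^ 2 * s1 n) (Y ^ 2 * RInt b a c))
  by (apply is_lim_seq_mult'; [now apply sq|exact l1]).
assert (lR : is_lim_seq (fun n => K ^ 2 * (s0 n + (sY n / (INR m * a)) ^ 2 * s2 n + err n))
  (K ^ 2 * (RInt (fun s => phi s ^ 2 * b s) 0 a +
           (Y / (INR m * a)) ^ 2 * RInt b c (c + INR m * a) + 0))).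
{ apply is_lim_seq_mult'; [apply is_lim_seq_const|].
  apply is_lim_seq_plus'; [|exact lerr].
  apply is_lim_seq_plus'; [exact l0|].
  apply is_lim_seq_mult'; [|exact l2]. apply sq.
  apply is_lim_seq_mult'; [exact lY|apply is_lim_seq_const]. }
rewrite Rplus_0_r in lR.
exact (is_lim_seq_le _ _ _ _ main lL lR).
Qed.

End IntegralCutoff.

(** * Finite energy and decay of orbits *)

Section Decay.
Context {H : HilbertSpace}.
Context (S : R -> H -> H) (M w_hat w K : R) (x y : H)
  (hS : C0_semigroup S) (M0 : 0 < M)
  (growth : forall t z, 0 <= t -> norm (S t z) <= M * exp (w_hat * t) * norm z)
  (K0 : 0 <= K) (hK : coercive_on_half_plane (generator S) w K)
  (hx : generator S x y).

(** The squared norm of the damped orbit.  The orbit is frozen at negative times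
    to get a function continuous on the whole line. *)
Definition energy (s t : R) : R := exp (- 2 * s * t) * norm (S (Rmax 0 t) x) ^ 2.

Lemma norm_reverse_triangle (u v : H) : Rabs (norm u - norm v) <= norm (minus u v).
Proof.
assert (h1 := norm_triangle_minus u v). assert (h2 := norm_triangle_minus v u).
rewrite (norm_minus_sym v u) in h2. unfold Rabs; destruct Rcase_abs; lra.
Qed.

Lemma orbit_norm_continuous t : continuous (fun t => norm (S (Rmax 0 t) x)) t.
Proof.
apply filterlim_locally. intros [e he].
destruct (orbit_continuous_eps S x (Rmax 0 t) hS (Rmax_l 0 t) e he) as [d [d0 hd]].
exists (mkposreal d d0). intros u hu.
change (Rabs (norm (S (Rmax 0 u) x) - norm (S (Rmax 0 t) x)) < e).
change (Rabs (u - t) < d) in hu.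
eapply Rle_lt_trans; [apply norm_reverse_triangle|].
apply hd; [apply Rmax_l|]. eapply Rle_lt_trans; [|exact hu].
unfold Rmax; destruct (Rle_dec 0 u), (Rle_dec 0 t); unfold Rabs;
  repeat destruct Rcase_abs; lra.
Qed.

Lemma energy_continuous s t : continuous (energy s) t.
Proof.
apply (continuous_mult (K := R_AbsRing) (fun t => exp (- 2 * s * t))
  (fun t => norm (S (Rmax 0 t) x) ^ 2)).
- apply (ex_derive_continuous (fun t => exp (- 2 * s * t))). auto_derive. exact I.
- apply (continuous_ext (fun t => norm (S (Rmax 0 t) x) * norm (S (Rmax 0 t) x)));
    [intros; simpl; ring|].
  apply (continuous_mult (K := R_AbsRing)); apply orbit_norm_continuous.
Qed.

Lemma energy_ge0 s t : 0 <= energy s t.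
Proof. apply Rmult_le_pos; [left; apply exp_pos|apply pow2_ge_0]. Qed.

Lemma energy_shift s s' t : energy s t = exp (2 * (s' - s) * t) * energy s' t.
Proof.
unfold energy. rewrite <- Rmult_assoc, <- exp_plus. do 2 f_equal. ring.
Qed.

Lemma energy_damped s t : 0 <= t -> energy s t = norm (damped (- s) S t x) ^ 2.
Proof.
intros ht. unfold energy, damped. rewrite Rmax_right by exact ht.
rewrite norm_RtoC_scal, Rabs_pos_eq by (left; apply exp_pos).
rewrite Rpow_mult_distr. f_equal. simpl. rewrite Rmult_1_r, <- exp_plus.
f_equal. ring.
Qed.

Lemma energy_cutoff s a D (l m : nat) (phi : R -> R) :
  w <= s -> 0 < a -> (0 < m)%nat -> 0 <= D ->
  (forall t, continuous phi t) -> (forall t, 0 <= t <= a -> Rabs (phi t) <= D) ->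
  let Y := RInt phi 0 a in
  let c := a + INR l * a in
  Y ^ 2 * RInt (energy s) a c <=
  K ^ 2 * (RInt (fun t => phi t ^ 2 * energy s t) 0 a +
           (Y / (INR m * a)) ^ 2 * RInt (energy s) c (c + INR m * a)).
Proof.
intros hs ha hm D0 cphi hphi.
apply (integral_cutoff (damped (- s) S) x (plus y (scal (RtoC (- s)) x)) K a D);
  auto.
- now apply damped_semigroup.
- intros T. exists (M * exp (Rabs (w_hat - s) * T)). split.
  + apply Rmult_le_pos; [lra|]. left; apply exp_pos.
  + intros t z ht. unfold damped. rewrite norm_RtoC_scal.
    rewrite Rabs_pos_eq by (left; apply exp_pos).
    eapply Rle_trans; [apply Rmult_le_compat_l; [left; apply exp_pos|apply growth; lra]|].
    rewrite <- !Rmult_assoc. apply Rmult_le_compat_r; [apply norm_ge_0|].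
    rewrite (Rmult_comm _ M), Rmult_assoc, <- exp_plus.
    apply Rmult_le_compat_l; [lra|].
    assert (le : - s * t + w_hat * t <= Rabs (w_hat - s) * T).
    { apply Rle_trans with (Rabs (w_hat - s) * t).
      - replace (- s * t + w_hat * t) with ((w_hat - s) * t) by ring.
        apply Rmult_le_compat_r; [lra|apply Rle_abs].
      - apply Rmult_le_compat_l; [apply Rabs_pos|lra]. }
    destruct le as [lt|<-]; [left; now apply exp_increasing|lra].
- now apply (damped_coercive S w).
- now apply (generator_damped S).
- apply energy_continuous.
- apply energy_damped.
Qed.

Lemma energy_RInt_mono s a b c : a <= b -> b <= c ->
  0 <= RInt (energy s) a b <= RInt (energy s) a c.
Proof.
intros hab hbc.
assert (ex : forall u v, ex_RInt (energy s) u v)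
  by (intros; apply continuous_ex_RInt, energy_continuous).
assert (pos : forall u v, u <= v -> 0 <= RInt (energy s) u v)
  by (intros u v huv; apply RInt_ge_0; auto; intros; apply energy_ge0).
rewrite (RInt_Chasles_R (energy s) a b c) by (apply energy_continuous).
generalize (pos a b hab) (pos b c hbc). lra.
Qed.

Definition total_energy (s a : R) (l : nat) : R := RInt (energy s) 0 (INR l * a).
Definition finite_energy (s a : R) : Prop :=
  exists C, forall l, total_energy s a l <= C.

(** The energy inequality with a plateau of l cells and a descent of m cells,
    for phi = 1, bounds the energy up to time (1 + l) a by a constant plus
    (K/(m a))^2 <= 1/4 times the energy up to time (1 + l + m) a.  A growth by a
    factor of at most 2 over m cells is therefore absorbed. *)
Lemma energy_absorption s a (m : nat) G D :
  w <= s -> 0 < a -> (0 < m)%nat -> 2 * K <= INR m * a -> 0 <= G -> G ^ m <= 2 ->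
  0 <= D -> (forall l, total_energy s a l <= D * G ^ l) ->
  finite_energy s a.
Proof.
intros hs ha hm hKm G0 Gm D0 gr.
assert (mp : 0 < INR m) by (apply lt_0_INR; lia).
assert (ma : 0 < INR m * a) by now apply Rmult_lt_0_compat.
set (q := (K / (INR m * a)) ^ 2).
assert (hq : 0 <= K / (INR m * a) <= / 2).
{ split; [apply Rmult_le_pos; [exact K0|left; now apply Rinv_0_lt_compat]|].
  apply Rmult_le_reg_r with (1 := ma). unfold Rdiv.
  rewrite Rmult_assoc, Rinv_l; lra. }
assert (q0 : 0 <= q <= / 4) by (unfold q; split; nra).
set (C := (1 + (K / a) ^ 2) * total_energy s a 1).
assert (T0 : forall l, 0 <= total_energy s a l).
{ intros l. apply (energy_RInt_mono s 0 (INR l * a) (INR l * a)); [|lra].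
  apply Rmult_le_pos; [apply pos_INR|lra]. }
assert (C0 : 0 <= C).
{ apply Rmult_le_pos; [|apply T0]. generalize (pow2_ge_0 (K / a)). lra. }
assert (bound : forall l, total_energy s a (1 + l) <= 2 * C).
{ apply (geometric_absorption _ C (D * G) G q m); try lra.
  - apply Rle_trans with (/ 4 * 2); [|lra].
    apply Rmult_le_compat; try lra. now apply pow_le.
  - intros l.
    assert (E := energy_cutoff s a 1 l m (fun _ => 1) hs ha hm ltac:(lra)
      ltac:(intros; apply (continuous_const (V := R_UniformSpace))) ltac:(intros; change (Rabs 1 <= 1); rewrite Rabs_R1; lra)).
    cbv zeta in E. rewrite RInt_const in E.
    change (scal (a - 0) 1) with ((a - 0) * 1) in E.
    replace ((a - 0) * 1) with a in E by ring.
    rewrite (RInt_ext (fun t => 1 ^ 2 * energy s t) (energy s)) in E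
      by (intros t _; change (1 ^ 2 * energy s t = energy s t); ring).
    set (c := a + INR l * a) in *.
    assert (la : 0 <= INR l * a) by (apply Rmult_le_pos; [apply pos_INR|lra]).
    assert (t1 : total_energy s a 1 = RInt (energy s) 0 a)
      by (unfold total_energy; f_equal; simpl; ring).
    assert (t2 : total_energy s a (1 + l) = RInt (energy s) 0 a + RInt (energy s) a c).
    { unfold total_energy. rewrite <- RInt_Chasles_R by apply energy_continuous.
      f_equal. rewrite plus_INR. unfold c. simpl. ring. }
    assert (t3 : RInt (energy s) c (c + INR m * a) <= total_energy s a (1 + (l + m))).
    { unfold total_energy.
      replace (INR (1 + (l + m)) * a) with (c + INR m * a)
        by (rewrite !plus_INR; unfold c; simpl; ring).
      rewrite (RInt_Chasles_R (energy s) 0 c (c + INR m * a)) by apply energy_continuous.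
      generalize (energy_RInt_mono s 0 c c ltac:(unfold c; lra) ltac:(lra)). lra. }
    rewrite t2.
    apply Rmult_le_reg_l with (a ^ 2); [apply pow_lt, ha|].
    rewrite Rmult_plus_distr_l.
    eapply Rle_trans; [apply Rplus_le_compat_l, E|].
    apply Rmult_le_compat_l with (r := (K * a / (INR m * a)) ^ 2) in t3;
      [|apply pow2_ge_0].
    apply Rle_trans with (a ^ 2 * total_energy s a 1 + K ^ 2 * total_energy s a 1 +
      (K * a / (INR m * a)) ^ 2 * total_energy s a (1 + (l + m))).
    + rewrite t1.
      replace (K ^ 2 * (RInt (energy s) 0 a + (a / (INR m * a)) ^ 2 * RInt (energy s) c (c + INR m * a)))
        with (K ^ 2 * RInt (energy s) 0 a + (K * a / (INR m * a)) ^ 2 * RInt (energy s) c (c + INR m * a))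
        by (unfold Rdiv; ring). lra.
    + apply Req_le. unfold C, q. field. split; apply Rgt_not_eq; assumption.
  - intros l. rewrite Rmult_assoc. exact (gr (1 + l)%nat).
  - now apply Rmult_le_pos. }
exists (2 * C). intros [|l].
- unfold total_energy. simpl. rewrite Rmult_0_l, RInt_point.
  change (0 <= 2 * C). lra.
- apply bound.
Qed.

Lemma exp_le (u v : R) : u <= v -> exp u <= exp v.
Proof. intros [h|<-]; [left; now apply exp_increasing|lra]. Qed.

Lemma exp_INR (u : R) n : exp (INR n * u) = exp u ^ n.
Proof.
induction n as [|n IH]; [simpl; rewrite Rmult_0_l; apply exp_0|].
rewrite S_INR, Rmult_plus_distr_r, exp_plus, IH, Rmult_1_l. simpl. ring.
Qed.

(** At w_hat the energy grows at most linearly, so it is bounded by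
    [energy_absorption].  Lowering s by eta multiplies the energy by at most
    exp(2 eta t), that is by 2 over m cells, and [energy_absorption] applies
    again.  Since eta depends on K and a only, finitely many steps reach w. *)
Lemma finite_energy_at_abscissa a : w < w_hat -> 0 < a -> finite_energy w a.
Proof.
intros hw ha.
destruct (nfloor_ex (2 * K / a) ltac:(apply Rmult_le_pos; [lra|left; now apply Rinv_0_lt_compat]))
  as [m0 [_ hm0]].
set (m := Datatypes.S m0).
assert (hm : (0 < m)%nat) by (unfold m; lia).
assert (mp : 0 < INR m) by (apply lt_0_INR; lia).
assert (ma : 0 < INR m * a) by now apply Rmult_lt_0_compat.
assert (hKm : 2 * K <= INR m * a).
{ unfold m. rewrite S_INR. apply Rmult_lt_compat_r with (r := a) in hm0; [|exact ha].
  unfold Rdiv in hm0. rewrite Rmult_assoc, Rinv_l in hm0; lra. }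
assert (l2 : 0 < ln 2) by (rewrite <- ln_1; apply ln_increasing; lra).
(* Chosen so that lowering s by eta multiplies the energy by at most 2 over m
   cells. *)
set (eta := ln 2 / (2 * (INR m * a))).
assert (eta0 : 0 < eta) by (apply Rdiv_lt_0_compat; lra).
set (G := exp (2 * eta * a)).
assert (G1 : 1 < G).
{ unfold G. rewrite <- exp_0. apply exp_increasing.
  apply Rmult_lt_0_compat; lra. }
assert (Gm : G ^ m <= 2).
{ unfold G. rewrite <- exp_INR.
  replace (INR m * (2 * eta * a)) with (ln 2) by (unfold eta; field; split; lra).
  rewrite exp_ln; lra. }
assert (ex : forall s u v, ex_RInt (energy s) u v)
  by (intros; apply continuous_ex_RInt, energy_continuous).
assert (la : forall l, 0 <= INR l * a)
  by (intros; apply Rmult_le_pos; [apply pos_INR|lra]).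
assert (base : finite_energy w_hat a).
{ set (B := (M * norm x) ^ 2).
  assert (B0 : 0 <= B) by apply pow2_ge_0.
  apply (energy_absorption w_hat a m G (B * a / (G - 1))); auto; try lra.
  - apply Rmult_le_pos; [nra|]. left; apply Rinv_0_lt_compat; lra.
  - intros l. unfold total_energy.
    apply Rle_trans with (INR l * a * B).
    + apply Rle_trans with (RInt (fun _ => B) 0 (INR l * a)).
      * apply RInt_le; [apply la|apply ex|apply ex_RInt_const|].
        intros t ht. unfold energy. rewrite Rmax_right by lra.
        assert (g := growth t x ltac:(lra)).
        apply Rle_trans with (exp (- 2 * w_hat * t) * (M * exp (w_hat * t) * norm x) ^ 2).
        -- apply Rmult_le_compat_l; [left; apply exp_pos|].
           apply pow_incr. split; [apply norm_ge_0|exact g].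
        -- replace (- 2 * w_hat * t) with (- (w_hat * t) + - (w_hat * t)) by ring.
           rewrite exp_plus, exp_Ropp. apply Req_le. unfold B. field.
           apply Rgt_not_eq, exp_pos.
      * rewrite RInt_const. apply Req_le. unfold scal; simpl; unfold mult; simpl. ring.
    + assert (P := poly l (G - 1) ltac:(lra)).
      replace (1 + (G - 1)) with G in P by ring.
      replace (INR l * a * B) with (B * a / (G - 1) * (INR l * (G - 1))) by (field; lra).
      apply Rmult_le_compat_l; [|lra].
      apply Rmult_le_pos; [nra|]. left; apply Rinv_0_lt_compat; lra. }
assert (descent : forall k, finite_energy (Rmax w (w_hat - INR k * eta)) a).
{ induction k as [|k [C hC]].
  - simpl. rewrite Rmult_0_l, Rminus_0_r, Rmax_right by lra. exact base.
  - rewrite S_INR.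
    set (s' := Rmax w (w_hat - INR k * eta)) in *.
    set (s := Rmax w (w_hat - (INR k + 1) * eta)).
    assert (hs : w <= s) by apply Rmax_l.
    assert (hss : s' - s <= eta).
    { unfold s, s', Rmax. destruct (Rle_dec w (w_hat - INR k * eta)),
        (Rle_dec w (w_hat - (INR k + 1) * eta)); lra. }
    assert (C0 : 0 <= C).
    { eapply Rle_trans; [|apply (hC 0%nat)].
      apply (energy_RInt_mono s' 0 (INR 0 * a) (INR 0 * a)); [apply la|lra]. }
    apply (energy_absorption s a m G C); auto; try lra.
    intros l. unfold total_energy.
    apply Rle_trans with (RInt (fun t => scal (G ^ l) (energy s' t)) 0 (INR l * a)).
    + apply RInt_le; [apply la|apply ex|apply (ex_RInt_scal (V := R_NormedModule)), ex|].
      intros t ht. rewrite (energy_shift s s').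
      change (exp (2 * (s' - s) * t) * energy s' t <= G ^ l * energy s' t).
      apply Rmult_le_compat_r; [apply energy_ge0|].
      unfold G. rewrite <- exp_INR. apply exp_le.
      apply Rle_trans with (2 * eta * t); [apply Rmult_le_compat_r; lra|].
      replace (INR l * (2 * eta * a)) with (2 * eta * (INR l * a)) by ring.
      apply Rmult_le_compat_l; lra.
    + rewrite (RInt_scal (V := R_CompleteNormedModule)) by apply ex.
      change (G ^ l * RInt (energy s') 0 (INR l * a) <= C * G ^ l).
      rewrite Rmult_comm. apply Rmult_le_compat_r; [apply pow_le; lra|apply hC]. }
destruct (nfloor_ex ((w_hat - w) / eta)) as [k [_ hk]].
{ apply Rmult_le_pos; [lra|left; now apply Rinv_0_lt_compat]. }
generalize (descent (Datatypes.S k)). rewrite S_INR, Rmax_left; [tauto|].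
apply Rmult_lt_compat_r with (r := eta) in hk; [|exact eta0].
unfold Rdiv in hk. rewrite Rmult_assoc, Rinv_l in hk; lra.
Qed.

(** The two bounds N E <= M |x| and 2 d N Y <= 2 d K M^2 |x|, where
    E = exp(-d t) and 2 d Y = 1 - E, are added: this replaces a discussion
    according to the size of t. *)
Lemma orbit_decay t : w < w_hat -> 0 <= t ->
  norm (S t x) <= M * (1 + 2 * M * (w_hat - w) * K) * exp (w * t) * norm x.
Proof.
intros hw [ht|<-].
2:{ assert (g := growth 0 x (Rle_refl 0)).
    rewrite (C0_zero S hS) in g |- *. rewrite Rmult_0_r, exp_0 in g |- *.
    rewrite Rmult_1_r in g |- *.
    assert (px := norm_ge_0 x).
    assert (0 <= M * (2 * M * (w_hat - w) * K) * norm x)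
      by (repeat apply Rmult_le_pos; lra).
    lra. }
set (d := w_hat - w). assert (d0 : 0 < d) by (unfold d; lra).
set (a := t / 2). assert (ha : 0 < a) by (unfold a; lra).
destruct (finite_energy_at_abscissa a hw ha) as [C hC].
set (phi := fun s => exp (- 2 * d * s)).
assert (cphi : forall s, continuous phi s).
{ intros s. apply (ex_derive_continuous phi). unfold phi. auto_derive. exact I. }
set (Y := RInt phi 0 a).
set (E := exp (- d * t)).
assert (EY : 2 * d * Y = 1 - E).
{ unfold Y, phi. rewrite RInt_exp by lra. rewrite Rmult_0_r, exp_0.
  replace (-2 * d * a) with (- d * t) by (unfold a; field).
  fold E. field. lra. }
assert (E1 : E < 1).
{ unfold E. rewrite <- exp_0. apply exp_increasing. nra. }
assert (Y0 : 0 < Y) by nra.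
set (N := exp (- w * t) * norm (S t x)).
assert (N0 : 0 <= N) by (apply Rmult_le_pos; [left; apply exp_pos|apply norm_ge_0]).
assert (ex : forall u v, ex_RInt (energy w) u v)
  by (intros; apply continuous_ex_RInt, energy_continuous).
assert (exphi : forall c u v, ex_RInt (fun s => scal c (phi s)) u v).
{ intros. apply (ex_RInt_scal (V := R_NormedModule)), continuous_ex_RInt, cphi. }
(* This choice of phi makes phi^2 times the a priori bound of the energy a
   multiple of phi itself, so that Y appears on both sides. *)
assert (up : RInt (fun s => phi s ^ 2 * energy w s) 0 a <= (M * norm x) ^ 2 * Y).
{ apply Rle_trans with (RInt (fun s => scal ((M * norm x) ^ 2) (phi s)) 0 a).
  2:{ rewrite (RInt_scal (V := R_CompleteNormedModule)); [apply Rle_refl|].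
      now apply continuous_ex_RInt. }
  apply RInt_le; [lra| |apply exphi|].
  - apply continuous_ex_RInt. intros s.
    apply (continuous_mult (K := R_AbsRing) (fun s => phi s ^ 2) (energy w));
      [|apply energy_continuous].
    apply (ex_derive_continuous (fun s => phi s ^ 2)). unfold phi. auto_derive. exact I.
  - intros s hs. change (phi s ^ 2 * energy w s <= (M * norm x) ^ 2 * phi s).
    unfold energy. rewrite Rmax_right by lra.
    assert (g := growth s x ltac:(lra)).
    apply Rle_trans with (phi s ^ 2 * (exp (- 2 * w * s) * (M * exp (w_hat * s) * norm x) ^ 2)).
    + apply Rmult_le_compat_l; [apply pow2_ge_0|].
      apply Rmult_le_compat_l; [left; apply exp_pos|].
      apply pow_incr. split; [apply norm_ge_0|exact g].
    + replace (-2 * w * s) with (- (w_hat * s) + (- (w_hat * s) + 2 * d * s))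
        by (unfold d; ring).
      unfold phi. replace (-2 * d * s) with (- (2 * d * s)) by ring.
      rewrite !exp_plus, !exp_Ropp.
      apply Req_le. field. split; apply Rgt_not_eq, exp_pos. }
(* S t x is reached from every earlier S s x by an operator whose norm is
   controlled, so the energy on [a, t] cannot be small. *)
assert (low : (N / M) ^ 2 * Y <= RInt (energy w) a (a + INR 1 * a)).
{ replace (a + INR 1 * a) with t by (unfold a; simpl; field).
  apply Rle_trans with (RInt (fun s => scal ((N / M) ^ 2 * exp (- 2 * d * t)) (exp (2 * d * s))) a t).
  - assert (cex : forall s, continuous (fun s => exp (2 * d * s)) s).
    { intros s. apply (ex_derive_continuous (fun s => exp (2 * d * s))). auto_derive. exact I. }
    rewrite (RInt_scal (V := R_CompleteNormedModule)) by (now apply continuous_ex_RInt).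
    rewrite RInt_exp by lra.
    change ((N / M) ^ 2 * Y <= (N / M) ^ 2 * exp (-2 * d * t) *
      ((exp (2 * d * t) - exp (2 * d * a)) / (2 * d))).
    rewrite Rmult_assoc. apply Req_le. f_equal.
    apply Rmult_eq_reg_l with (2 * d); [|lra]. rewrite EY.
    replace (2 * d * (exp (-2 * d * t) * ((exp (2 * d * t) - exp (2 * d * a)) / (2 * d))))
      with (exp (-2 * d * t) * exp (2 * d * t) - exp (-2 * d * t) * exp (2 * d * a))
      by (field; lra).
    rewrite <- !exp_plus. unfold E.
    replace (-2 * d * t + 2 * d * t) with 0 by ring.
    replace (-2 * d * t + 2 * d * a) with (- d * t) by (unfold a; field).
    now rewrite exp_0.
  - apply RInt_le; [unfold a; lra| |apply ex|].
    + apply (ex_RInt_scal (V := R_NormedModule)), continuous_ex_RInt. intros s.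
      apply (ex_derive_continuous (fun s => exp (2 * d * s))). auto_derive. exact I.
    + intros s hs.
      change ((N / M) ^ 2 * exp (-2 * d * t) * exp (2 * d * s) <= energy w s).
      unfold energy. rewrite Rmax_right by lra.
      assert (g := growth (t - s) (S s x) ltac:(lra)).
      rewrite <- (C0_add S hS) in g by lra.
      replace (t - s + s) with t in g by ring.
      set (P := norm (S t x)) in *. set (Q := norm (S s x)) in *.
      replace ((N / M) ^ 2 * exp (-2 * d * t) * exp (2 * d * s))
        with ((N / M * exp (- d * (t - s))) ^ 2).
      2:{ replace (-2 * d * t) with (- d * (t - s) + (- d * (t - s) + - (2 * d * s))) by ring.
          rewrite !exp_plus, exp_Ropp. field. split; [apply Rgt_not_eq, exp_pos|lra]. }
      replace (exp (-2 * w * s) * Q ^ 2) with ((exp (- w * s) * Q) ^ 2).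
      2:{ replace (-2 * w * s) with (- w * s + - w * s) by ring. rewrite exp_plus. ring. }
      apply pow_incr. split.
      * apply Rmult_le_pos; [|left; apply exp_pos].
        apply Rmult_le_pos; [exact N0|left; now apply Rinv_0_lt_compat].
      * unfold N.
        apply Rle_trans with (exp (- w * t) * (M * exp (w_hat * (t - s)) * Q) / M *
          exp (- d * (t - s))).
        -- apply Rmult_le_compat_r; [left; apply exp_pos|].
           apply Rmult_le_compat_r; [left; now apply Rinv_0_lt_compat|].
           apply Rmult_le_compat_l; [left; apply exp_pos|exact g].
        -- replace (- w * s) with (- w * t + (w_hat * (t - s) + - d * (t - s)))
             by (unfold d; ring).
           rewrite !exp_plus. apply Req_le. field. lra. }
assert (cut : Y ^ 2 * RInt (energy w) a (a + INR 1 * a) <=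
              K ^ 2 * RInt (fun s => phi s ^ 2 * energy w s) 0 a).
{ set (A := RInt (fun s => phi s ^ 2 * energy w s) 0 a).
  assert (each : forall n, Y ^ 2 * RInt (energy w) a (a + INR 1 * a) <=
      K ^ 2 * (A + mesh (Y / a) n ^ 2 * C)).
  { intros n.
    eapply Rle_trans.
    - apply (energy_cutoff w a 1 1 (Datatypes.S n) phi); auto; try lra; try lia.
      intros s hs. unfold phi. rewrite Rabs_pos_eq by (left; apply exp_pos).
      rewrite <- exp_0. apply exp_le. nra.
    - apply Rmult_le_compat_l; [apply pow2_ge_0|]. apply Rplus_le_compat_l.
      fold Y. replace (Y / (INR (Datatypes.S n) * a)) with (mesh (Y / a) n).
      2:{ unfold mesh. field. split; [lra|apply not_0_INR; lia]. }
      apply Rmult_le_compat_l; [apply pow2_ge_0|].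
      eapply Rle_trans; [|apply (hC (2 + Datatypes.S n)%nat)].
      unfold total_energy.
      replace (INR (2 + Datatypes.S n) * a) with (a + INR 1 * a + INR (Datatypes.S n) * a)
        by (rewrite plus_INR; simpl (INR 2); simpl (INR 1); ring).
      assert (p := pos_INR (Datatypes.S n)).
      set (c := a + INR 1 * a).
      rewrite (RInt_Chasles_R (energy w) 0 c (c + _)) by apply energy_continuous.
      generalize (energy_RInt_mono w 0 c c ltac:(unfold c; simpl; lra) ltac:(lra)). lra. }
  assert (lim : is_lim_seq (fun n => K ^ 2 * (A + mesh (Y / a) n ^ 2 * C))
                  (K ^ 2 * (A + 0 * 0 * C))).
  { apply is_lim_seq_mult'; [apply is_lim_seq_const|].
    apply is_lim_seq_plus'; [apply is_lim_seq_const|].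
    apply is_lim_seq_mult'; [|apply is_lim_seq_const].
    apply (is_lim_seq_ext (fun n => mesh (Y / a) n * mesh (Y / a) n));
      [intros; ring|].
    apply is_lim_seq_mult'; apply mesh_lim. }
  replace (K ^ 2 * (A + 0 * 0 * C)) with (K ^ 2 * A) in lim by ring.
  exact (is_lim_seq_le _ _ _ _ each (is_lim_seq_const _) lim). }
assert (px := norm_ge_0 x).
assert (NY : N * Y <= K * M * M * norm x).
{ apply Rsqr_incr_0_var; [|repeat apply Rmult_le_pos; lra].
  apply Rmult_le_compat_l with (r := Y ^ 2) in low; [|apply pow2_ge_0].
  apply Rmult_le_compat_l with (r := K ^ 2) in up; [|apply pow2_ge_0].
  assert (c : Y ^ 2 * ((N / M) ^ 2 * Y) <= K ^ 2 * ((M * norm x) ^ 2 * Y)) by lra.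
  rewrite <- !Rmult_assoc in c. apply Rmult_le_reg_r in c; [|exact Y0].
  apply Rmult_le_compat_r with (r := M ^ 2) in c; [|apply pow2_ge_0].
  unfold Rsqr.
  replace (N * Y * (N * Y)) with (Y ^ 2 * (N / M) ^ 2 * M ^ 2) by (field; lra).
  replace (K * M * M * norm x * (K * M * M * norm x)) with
    (K ^ 2 * (M * norm x) ^ 2 * M ^ 2) by ring. exact c. }
assert (NE : N * E <= M * norm x).
{ unfold N, E.
  apply Rle_trans with (exp (- w * t) * (M * exp (w_hat * t) * norm x) * exp (- d * t)).
  - apply Rmult_le_compat_r; [left; apply exp_pos|].
    apply Rmult_le_compat_l; [left; apply exp_pos|]. apply growth. lra.
  - replace (exp (- w * t) * (M * exp (w_hat * t) * norm x) * exp (- d * t))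
      with (M * norm x * (exp (- w * t) * exp (w_hat * t) * exp (- d * t))) by ring.
    rewrite <- !exp_plus.
    replace (- w * t + w_hat * t + - d * t) with 0 by (unfold d; ring).
    rewrite exp_0. lra. }
(* The weights E and 1 - E = 2 d Y add up to 1. *)
assert (NN : N <= M * (1 + 2 * M * d * K) * norm x).
{ replace N with (N * E + 2 * d * (N * Y)) by (rewrite <- Rmult_assoc, (Rmult_comm _ N),
    Rmult_assoc, EY; ring).
  apply Rmult_le_compat_l with (r := 2 * d) in NY; [|lra]. lra. }
apply Rmult_le_compat_l with (r := exp (w * t)) in NN; [|left; apply exp_pos].
unfold N in NN. rewrite <- Rmult_assoc, <- exp_plus in NN.
replace (w * t + - w * t) with 0 in NN by ring. rewrite exp_0 in NN.
fold d. lra.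
Qed.

End Decay.

Theorem proposition2p1 (H : HilbertSpace) (S : R -> H -> H) (M w_hat w : R)
  (hS : C0_semigroup S)
  (hM : 1 <= M)
  (hbound : forall t : R, 0 <= t -> op_norm (S t) <= M * exp (w_hat * t))
  (hw : w < w_hat)
  (hr : Rbar_lt 0 (r (generator S) w)) :
  forall t : R, 0 <= t ->
    op_norm (S t) <=
      M * (1 + real (Rbar_div (2 * M * (w_hat - w)) (r (generator S) w)))
        * exp (w * t).
Proof.
intros t ht.
destruct (proj1 (r_gt0 _ _) hr) as [ex fin].
assert (hK := resolvent_coercive (generator S) w ex fin).
set (K := real (resolvent_sup (generator S) w)) in *.
assert (supK : resolvent_sup (generator S) w = Finite K) by (symmetry; exact fin).
(* When K = 0 the radius r is +oo and the quotient is 0, in agreement with the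
   formula. *)
assert (div : real (Rbar_div (2 * M * (w_hat - w)) (r (generator S) w)) =
              2 * M * (w_hat - w) * K /\ 0 <= K).
{ revert hr. unfold r. rewrite supK. unfold Rbar_recip, Rbar_div.
  destruct (Req_EM_T K 0) as [->|k0]; simpl; intros hr'.
  - split; lra.
  - split; [now rewrite Rinv_inv|]. rewrite <- Rinv_inv.
    left. now apply Rinv_0_lt_compat. }
destruct div as [-> K0].
assert (growth : forall t z, 0 <= t -> norm (S t z) <= M * exp (w_hat * t) * norm z).
{ intros u z hu. eapply Rle_trans.
  - apply norm_le_op_norm. now apply (C0_bounded S hS).
  - apply Rmult_le_compat_r; [apply norm_ge_0|now apply hbound]. }
set (B := M * (1 + 2 * M * (w_hat - w) * K) * exp (w * t)).
assert (B0 : 0 <= B).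
{ repeat apply Rmult_le_pos; try lra; [|left; apply exp_pos].
  apply Rplus_le_le_0_compat; [lra|]. repeat apply Rmult_le_pos; lra. }
apply op_norm_le; [exact B0|]. intros x.
apply le_epsilon. intros e he.
assert (pe := exp_pos (w_hat * t)).
assert (L0 : 0 <= M * exp (w_hat * t)) by (apply Rmult_le_pos; lra).
set (k := e / (M * exp (w_hat * t) + B + 1)).
assert (k0 : 0 < k) by (apply Rdiv_lt_0_compat; lra).
destruct (generator_dense S (RtoC w) hS (ex (RtoC w) (Rle_refl w)) x k k0)
  as [p [p' [hp hpx]]].
assert (g := orbit_decay S M w_hat w K p p' hS ltac:(lra) growth K0 hK hp t hw ht).
fold B in g.
assert (t1 := linear_lipschitz (S t) _ x p (C0_bounded S hS t ht) (fun z => growth t z ht)).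
assert (t2 := norm_triangle_minus p x).
assert (i1 : B * norm p <= B * (k + norm x)) by (apply Rmult_le_compat_l; lra).
assert (i2 : M * exp (w_hat * t) * norm (minus p x) <= M * exp (w_hat * t) * k)
  by (apply Rmult_le_compat_l; lra).
assert (ke : k * (M * exp (w_hat * t) + B + 1) = e) by (unfold k; field; lra).
lra.
Qed.
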